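(* Let $A\in\mathbb{R}^{n_x\times n_x}$, $B\in\mathbb{R}^{n_x\times n_u}$, $B_w\in\mathbb{R}^{n_x\times n_w}$, $Q\in\mathbb{R}^{n_x\times n_x}$, $R\in\mathbb{R}^{n_u\times n_u}$ satisfy the standing assumptions given in the context, with full state measurement (i.e. $C=I_{n_x}$), and let $\mathcal{K}$ and $J:\mathcal{K}\to\mathbb{R}_+$ be the associated stabilizing set and $\mathcal{H}_\infty$ cost. Then, for every $K\in\mathcal{K}$, $$0\in\partial J(K)\quad\Longleftrightarrow\quad K\in\arg\min_{K'\in\mathcal{K}}J(K'),$$ where $\partial J(K)$ denotes the Clarke subdifferential of $J$ at $K$.
   Context: Standing assumptions: $(A,B)$ is stabilizable; $B_w$ has full row rank; $Q$ and $R$ are (symmetric) positive definite; and the set of stabilizing static state-feedback gains $$\mathcal{K}:=\{K\in\mathbb{R}^{n_u\times n_x}\mid\rho(A+BK)<1\}$$ is nonempty, where $\rho(\cdot)$ denotes the spectral radius of a matrix. (This is the case $C=I_{n_x}$ of static output feedback $u_t=Ky_t$, $y_t=Cx_t$.) For $K\in\mathcal{K}$ and $\omega\in[0,2\pi]$, define the $(n_x+n_u)\times n_w$ complex matrix $$\mathbf{T}_{zw}(K,\omega)=\begin{bmatrix}Q^{1/2}\\ R^{1/2}K\end{bmatrix}\left(e^{j\omega}I-(A+BK)\right)^{-1}B_w,$$ with $j$ the imaginary unit, and the $\mathcal{H}_\infty$ cost $$J(K):=\|\mathbf{T}_{zw}(K)\|_{\mathcal{H}_\infty}=\max_{\omega\in[0,2\pi]}\sigma_{\max}(\mathbf{T}_{zw}(K,\omega)),$$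 where $\sigma_{\max}$ is the largest singular value. *)

(* Defs.v *)
From HB Require Import structures.
From mathcomp Require Import all_boot all_order all_algebra.
From mathcomp Require Import spectral.
From mathcomp Require Import complex.
From mathcomp Require Import all_classical all_reals all_analysis.

Set Implicit Arguments.
Unset Strict Implicit.
Unset Printing Implicit Defensive.

Import Order.TTheory GRing.Theory Num.Theory.
Import numFieldNormedType.Exports.

Local Open Scope classical_set_scope.
Local Open Scope ring_scope.
Local Open Scope complex_scope.
Local Open Scope sesquilinear_scope.

Section Matrices.
Variable R : realType.

Definition complexmx m n (M : 'M[R]_(m, n)) : 'M[R[i]]_(m, n) :=
  map_mx (fun x : R => x%:C) M.

Definition positive_definite n (M : 'M[R]_n) : Prop :=
  M^T = M /\ forall x : 'cV[R]_n, x != 0 -> 0 < (x^T *m M *m x) 0 0.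

Definition positive_semidefinite n (M : 'M[R]_n) : Prop :=
  M^T = M /\ forall x : 'cV[R]_n, 0 <= (x^T *m M *m x) 0 0.

(* The square root of a positive semidefinite matrix exists and is unique, so
   the choice made by [xget] (and its default 0) is immaterial there. *)
Definition psd_sqrt n (M : 'M[R]_n) : 'M[R]_n :=
  xget 0 [set S | positive_semidefinite S /\ S *m S = M].

(* Largest modulus of a complex eigenvalue; the set is finite, and it is empty
   (giving 0) only for n = 0. *)
Definition spectral_radius n (M : 'M[R]_n) : R :=
  sup [set Normc.normc l | l in [set l : R[i] | eigenvalue (complexmx M) l]].

(* The singular values of M are the nonnegative square roots of the eigenvalues
   of M^* M; if n > m, this list has additional zeros, which do not affect the
   largest one.  The supremum is 0 if n = 0. *)
Definition singular_values m n (M : 'M[R[i]]_(m, n)) : set R :=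
  [set s | 0 <= s /\ eigenvalue (M ^t* *m M) (s ^+ 2)%:C].

Definition sigma_max m n (M : 'M[R[i]]_(m, n)) : R := sup (singular_values M).

End Matrices.

Section Clarke.
Variable R : realType.

(* Generalized directional derivative
   limsup_{y -> x, t -> 0+} (f (y + t d) - f y) / t.
   Only the values of f in a neighbourhood of x matter. *)
Definition clarke_derivative (V : normedModType R) (f : V -> R) (x d : V)
    : \bar R :=
  limf_esup (fun p : V * R => ((f (p.1 + p.2 *: d) - f p.1) / p.2)%:E)
            (filter_prod (nbhs x) (0 : R)^'+).

(* Clarke subdifferential for the trace inner product <V, D> = tr (V^T D). *)
Definition clarke_subdifferential m n (f : 'M[R]_(m, n) -> R) (X : 'M[R]_(m, n))
    : set 'M[R]_(m, n) :=
  [set V | forall D : 'M[R]_(m, n),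
     ((\tr (V^T *m D))%:E <= clarke_derivative f X D)%E].

Definition argmin (T : Type) (S : set T) (f : T -> R) : set T :=
  [set x | S x /\ forall y, S y -> f x <= f y].

End Clarke.

Section StateFeedback.
Variables (R : realType) (nx nu nw : nat).
Variables (A : 'M[R]_nx) (B : 'M[R]_(nx, nu)) (Bw : 'M[R]_(nx, nw)).
Variables (Q : 'M[R]_nx) (Ru : 'M[R]_nu).

(* The gains K with A + B K Schur stable. *)
Definition stabilizing_gains : set 'M[R]_(nu, nx) :=
  [set K | spectral_radius (A + B *m K) < 1].

Definition stabilizable : Prop :=
  exists F : 'M[R]_(nu, nx), spectral_radius (A + B *m F) < 1.

Definition cexpi (w : R) : R[i] := cos w +i* sin w.

(* [invmx] is the genuine inverse when K is stabilizing, since then no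
   eigenvalue of A + B K lies on the unit circle. *)
Definition Tzw (K : 'M[R]_(nu, nx)) (w : R) : 'M[R[i]]_(nx + nu, nw) :=
  complexmx (col_mx (psd_sqrt Q) (psd_sqrt Ru *m K))
    *m invmx ((cexpi w)%:M - complexmx (A + B *m K))
    *m complexmx Bw.

(* A total function; it is the H-infinity norm of the closed loop on
   [stabilizing_gains], which is open.  There the supremum is a maximum, being
   that of a continuous function on a compact interval. *)
Definition hinf_cost (K : 'M[R]_(nu, nx)) : R :=
  sup [set sigma_max (Tzw K w) | w in `[0, 2 * pi]].

End StateFeedback.

(* Main.v *)
Require Import Defs.
From mathcomp Require Import all_boot all_order all_algebra.
From mathcomp Require Import spectral complex ring lra.
From mathcomp Require Import all_classical all_reals all_analysis.

Set Implicit Arguments.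
Unset Strict Implicit.
Unset Printing Implicit Defensive.

Import Order.TTheory GRing.Theory Num.Theory.
Import numFieldNormedType.Exports.

Local Open Scope classical_set_scope.
Local Open Scope ring_scope.
Local Open Scope complex_scope.
Local Open Scope sesquilinear_scope.

(** Stationary gains are optimal because the problem is convex in other
    coordinates, and because the cost is smooth enough for descent along a curve
    in the original coordinates to be seen by the Clarke derivative.

    Hidden convexity. Call [P] a certificate of level [b] for the gain [K] if
    every closed-loop step from [x] to [x' = (A + B K) x + Bw w] satisfies
    [x'^T P x' + x^T Q x + (K x)^T Ru (K x) <= x^T P x + b |w|^2]. A positive
    definite certificate makes [K] stabilizing with cost at most [sqrt b]
    ([dissipative_stable], [dissipative_cost]). In the variables [X = P^-1] and
    [L = K X] the pairs of a gain and a certificate form a convex set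
    ([dissipative_comb]), since [y^T X^-1 y] is jointly convex in [(X, y)].

    Certificates exist at the optimal level [b = J K ^+ 2] ([bounded_real]). The
    certificate is the available storage, the supremum over inputs of the energy
    extracted from an initial state. Parseval's identity for the discrete Fourier
    transform shows that a trajectory which starts and ends at [0] extracts no
    energy ([closed_loop_gain]). As [Bw] has full row rank, any state can be
    reached from [0] in one step and, after a long free decay, steered back to
    [0] at negligible cost, so the available storage is finite. As a supremum
    of jointly quadratic functions it obeys the parallelogram law, hence is a
    quadratic form ([parallelogram_quad]).

    Descent. If [J K' < J K], the segment between the two certificates yields
    for each small [s] a gain [K + s D], with [D] bounded, such that
    [J (K + s D) <= J K - s e] ([descent_steps]). Near [K] the cost is Lipschitz
    and convex up to a quadratic error ([hinf_cost_local]), because it is a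
    supremum of norms of matrices whose second derivatives in the gain are
    bounded uniformly in the frequency. For one small [s] these two facts spread
    the decrease to all base points near [K] and all shorter steps along [D], so
    the Clarke derivative at [K] in the direction [D] is negative
    ([weakly_convex_descent]) and [0] is not a subgradient.

    Conversely, stabilizing gains form an open set, so a minimizer over them is a
    local minimizer, at which the Clarke derivative is nonnegative in every
    direction.

    Complex vectors are measured by the Euclidean norm [cnorm], and the largest
    singular value enters only as the operator norm ([sigma_max_le],
    [sigma_max_bound]). Stability is used as summability of the orbits
    [A^k v] ([stable_orbit_sum]), which follows from the Cayley-Hamilton theorem. *)

(** * Real quadratic forms *)

Section RealForms.
Variable R : realType.

Definition dot n (x y : 'cV[R]_n) : R := (x^T *m y) 0 0.
Definition sqn n (x : 'cV[R]_n) : R := dot x x.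
Definition quad n (P : 'M[R]_n) (x : 'cV[R]_n) : R := dot x (P *m x).

Lemma quadE n (P : 'M[R]_n) x : (x^T *m P *m x) 0 0 = quad P x.
Proof. by rewrite /quad /dot mulmxA. Qed.

Lemma dotE n (x y : 'cV[R]_n) : dot x y = \sum_i x i 0 * y i 0.
Proof. by rewrite /dot mxE; apply: eq_bigr => i _; rewrite mxE. Qed.

Lemma sqnE n (x : 'cV[R]_n) : sqn x = \sum_i x i 0 ^+ 2.
Proof. by rewrite /sqn dotE. Qed.

Lemma dotC n (x y : 'cV[R]_n) : dot x y = dot y x.
Proof. by rewrite !dotE; apply: eq_bigr => i _; rewrite mulrC. Qed.

Lemma dotDl n (x y z : 'cV[R]_n) : dot (x + y) z = dot x z + dot y z.
Proof. by rewrite /dot linearD /= mulmxDl mxE. Qed.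

Lemma dotDr n (x y z : 'cV[R]_n) : dot x (y + z) = dot x y + dot x z.
Proof. by rewrite /dot mulmxDr mxE. Qed.

Lemma dotZl n a (x y : 'cV[R]_n) : dot (a *: x) y = a * dot x y.
Proof. by rewrite /dot linearZ /= -scalemxAl mxE. Qed.

Lemma dotZr n a (x y : 'cV[R]_n) : dot x (a *: y) = a * dot x y.
Proof. by rewrite /dot -scalemxAr mxE. Qed.

Lemma dotNr n (x y : 'cV[R]_n) : dot x (- y) = - dot x y.
Proof. by rewrite -scaleN1r dotZr mulN1r. Qed.

Lemma dot_adj m n (M : 'M[R]_(m, n)) x y : dot x (M *m y) = dot (M^T *m x) y.
Proof. by rewrite /dot trmx_mul trmxK mulmxA. Qed.

Lemma sqn_ge0 n (x : 'cV[R]_n) : 0 <= sqn x.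
Proof. by rewrite sqnE sumr_ge0 // => i _; rewrite sqr_ge0. Qed.

Lemma sqn_eq0 n (x : 'cV[R]_n) : sqn x = 0 -> x = 0.
Proof.
rewrite sqnE => /eqP; rewrite psumr_eq0 => [/allP h|i _]; last exact: sqr_ge0.
apply/matrixP => i j; rewrite ord1 mxE.
by have := h i (mem_index_enum i); rewrite /= sqrf_eq0 => /eqP.
Qed.

Lemma sqn0 n : sqn (0 : 'cV[R]_n) = 0.
Proof. by rewrite sqnE big1 // => i _; rewrite mxE expr0n. Qed.

Lemma sqnD n (x y : 'cV[R]_n) : sqn (x + y) = sqn x + 2 * dot x y + sqn y.
Proof. by rewrite /sqn !dotDl !dotDr (dotC y x); ring. Qed.

Lemma sqnZ n a (x : 'cV[R]_n) : sqn (a *: x) = a ^+ 2 * sqn x.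
Proof. by rewrite /sqn dotZl dotZr; ring. Qed.

Lemma sqnN n (x : 'cV[R]_n) : sqn (- x) = sqn x.
Proof. by rewrite -scaleN1r sqnZ sqrrN expr1n mul1r. Qed.

Lemma sqn_col_mx m n (x : 'cV[R]_m) (y : 'cV[R]_n) :
  sqn (col_mx x y) = sqn x + sqn y.
Proof. by rewrite /sqn /dot tr_col_mx mul_row_col mxE. Qed.

Lemma sqn_mul m n (M : 'M[R]_(m, n)) x : sqn (M *m x) = quad (M^T *m M) x.
Proof. by rewrite /sqn /quad dot_adj dotC -mulmxA. Qed.

Lemma sqn_quad1 n (x : 'cV[R]_n) : sqn x = quad 1%:M x.
Proof. by rewrite /quad mul1mx. Qed.

Lemma quadD n (P : 'M[R]_n) x y : P^T = P ->
  quad P (x + y) = quad P x + 2 * dot x (P *m y) + quad P y.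
Proof.
move=> sP; rewrite /quad mulmxDr !dotDl !dotDr.
by rewrite (dot_adj P y x) sP (dotC _ x); ring.
Qed.

Lemma quadZ n (P : 'M[R]_n) a x : quad P (a *: x) = a ^+ 2 * quad P x.
Proof. by rewrite /quad -scalemxAr dotZl dotZr; ring. Qed.

Lemma quadN n (P : 'M[R]_n) x : quad P (- x) = quad P x.
Proof. by rewrite -scaleN1r quadZ sqrrN expr1n mul1r. Qed.

Lemma quad0 n (P : 'M[R]_n) : quad P 0 = 0.
Proof. by rewrite -(scale0r 0) quadZ expr0n mul0r. Qed.

Lemma posdef_quad n (P : 'M[R]_n) :
  positive_definite P -> forall x, x != 0 -> 0 < quad P x.
Proof. by case=> _ h x /h; rewrite quadE. Qed.

Lemma posdef_quad_ge0 n (P : 'M[R]_n) :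
  positive_definite P -> forall x, 0 <= quad P x.
Proof.
move=> pP x; have [->|x0] := eqVneq x 0; first by rewrite quad0.
exact: ltW (posdef_quad pP x0).
Qed.

(** Nonnegativity of the form along the line through [x] and [y], taken at the
    minimizing parameter. *)
Lemma quad_cauchy_schwarz n (P : 'M[R]_n) x y : P^T = P ->
  (forall x, 0 <= quad P x) -> dot x (P *m y) ^+ 2 <= quad P x * quad P y.
Proof.
move=> sP P0; set b := dot x _.
have h t : 0 <= quad P x + 2 * t * b + t ^+ 2 * quad P y.
  have := P0 (x + t *: y); rewrite quadD // -scalemxAr dotZr quadZ -/b.
  by rewrite mulrA.
have := P0 y; rewrite le_eqVlt => /predU1P[y0|y0].
  rewrite -y0 mulr0; have [->|b0] := eqVneq b 0; first by rewrite expr0n.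
  have := h (- (quad P x + 1) / (2 * b)); rewrite -y0 mulr0 addr0.
  have -> : 2 * (- (quad P x + 1) / (2 * b)) * b = - (quad P x + 1) by field.
  lra.
have := h (- b / quad P y).
have -> : quad P x + 2 * (- b / quad P y) * b + (- b / quad P y) ^+ 2 * quad P y
  = (quad P x * quad P y - b ^+ 2) / quad P y by field; rewrite gt_eqF.
by rewrite pmulr_lge0 ?invr_gt0 // subr_ge0.
Qed.

Lemma cauchy_schwarz n (x y : 'cV[R]_n) : dot x y ^+ 2 <= sqn x * sqn y.
Proof.
have := @quad_cauchy_schwarz n 1%:M x y (trmx1 _ _); rewrite mul1mx !sqn_quad1.
by apply => z; rewrite -sqn_quad1 sqn_ge0.
Qed.

Lemma sqrt_sqn_triangle n (x y : 'cV[R]_n) :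
  Num.sqrt (sqn (x + y)) <= Num.sqrt (sqn x) + Num.sqrt (sqn y).
Proof.
have a0 := sqrtr_ge0 (sqn x); have b0 := sqrtr_ge0 (sqn y).
rewrite -[leRHS]ger0_norm ?addr_ge0 // -sqrtr_sqr ler_sqrt ?sqr_ge0 //.
rewrite sqnD sqrrD !sqr_sqrtr ?sqn_ge0 // lerD2r lerD2l -[leRHS]mulr_natl ler_pM2l //.
apply: le_trans (ler_norm _) _; rewrite -sqrtr_sqr -sqrtrM ?sqn_ge0 //.
by rewrite ler_sqrt ?mulr_ge0 ?sqn_ge0 // cauchy_schwarz.
Qed.

Lemma posdef_unit n (P : 'M[R]_n) : positive_definite P -> P \in unitmx.
Proof.
move=> pP; rewrite -unitmx_tr -row_free_unit -kermx_eq0; apply/eqP/row_matrixP => i.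
rewrite row0; apply/eqP/negPn/negP => r0.
have kr : row i (kermx P^T) *m P^T = 0 by rewrite -row_mul mulmx_ker row0.
set r := row i _ in r0 kr.
have r0' : r^T != 0 by rewrite -(inj_eq (@trmx_inj _ _ _)) trmxK trmx0.
have := posdef_quad pP r0'.
by rewrite /quad -[P *m r^T]trmxK trmx_mul trmxK kr /dot trmx0 mulmx0 mxE ltxx.
Qed.

Lemma posdef_inv n (P : 'M[R]_n) :
  positive_definite P -> positive_definite (invmx P).
Proof.
move=> pP; have uP := posdef_unit pP; case: (pP) => sP _.
have sI : (invmx P)^T = invmx P by rewrite trmx_inv sP.
split=> // x x0; rewrite quadE.
have -> : quad (invmx P) x = quad P (invmx P *m x).
  by rewrite /quad (dotC (invmx P *m x)) mulmxA mulmxV // mul1mx.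
apply: posdef_quad => //; apply: contra_neq x0 => h.
by rewrite -[x]mul1mx -(mulmxV uP) -mulmxA h mulmx0.
Qed.

End RealForms.

(** * Complex vectors *)

Section ComplexVectors.
Variable R : realType.
Local Notation C := R[i].

Definition rpart m n (v : 'M[C]_(m, n)) : 'M[R]_(m, n) := map_mx (@complex.Re R) v.
Definition ipart m n (v : 'M[C]_(m, n)) : 'M[R]_(m, n) := map_mx (@complex.Im R) v.
(** For symmetric [P] this is the Hermitian form [v^* P v]. Splitting it into real
    and imaginary parts lets a real quadratic inequality be used on complex
    vectors by adding its instances at the two parts. *)
Definition cquad n (P : 'M[R]_n) (v : 'cV[C]_n) : R :=
  quad P (rpart v) + quad P (ipart v).
Definition csqn n (v : 'cV[C]_n) : R := sqn (rpart v) + sqn (ipart v).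
Definition cnorm n (v : 'cV[C]_n) : R := Num.sqrt (csqn v).

Lemma rpartD m n (u v : 'M[C]_(m, n)) : rpart (u + v) = rpart u + rpart v.
Proof. by apply/matrixP => i j; rewrite !mxE; case: (u i j) (v i j) => ? ? []. Qed.

Lemma ipartD m n (u v : 'M[C]_(m, n)) : ipart (u + v) = ipart u + ipart v.
Proof. by apply/matrixP => i j; rewrite !mxE; case: (u i j) (v i j) => ? ? []. Qed.

Lemma rpartZ m n a (u : 'M[C]_(m, n)) :
  rpart (a *: u) = complex.Re a *: rpart u - complex.Im a *: ipart u.
Proof. by apply/matrixP => i j; rewrite !mxE; case: a (u i j) => ? ? []. Qed.

Lemma ipartZ m n a (u : 'M[C]_(m, n)) :
  ipart (a *: u) = complex.Re a *: ipart u + complex.Im a *: rpart u.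
Proof.
by apply/matrixP => i j; rewrite !mxE; case: a (u i j) => a b [c d] /=; ring.
Qed.

Lemma reim_eq0 m n (u : 'M[C]_(m, n)) : rpart u = 0 -> ipart u = 0 -> u = 0.
Proof.
move=> /matrixP hr /matrixP hi; apply/matrixP => i j.
by move: (hr i j) (hi i j); rewrite !mxE; case: (u i j) => a b /= -> ->.
Qed.

Lemma complexmxD m n (M N : 'M[R]_(m, n)) :
  complexmx (M + N) = complexmx M + complexmx N.
Proof. exact: (map_mxD (real_complex R)). Qed.

Lemma complexmxM m n p (M : 'M[R]_(m, n)) (N : 'M[R]_(n, p)) :
  complexmx (M *m N) = complexmx M *m complexmx N.
Proof. exact: (map_mxM (real_complex R)). Qed.

Lemma complexmxZ m n a (M : 'M[R]_(m, n)) :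
  complexmx (a *: M) = a%:C *: complexmx M.
Proof. exact: (map_mxZ (real_complex R)). Qed.

Lemma complexmx_inj m n : injective (@complexmx R m n).
Proof.
move=> M N /matrixP h; apply/matrixP => i j.
by have := h i j; rewrite !mxE => -[].
Qed.

Lemma rpart_complexmx m n (M : 'M[R]_(m, n)) : rpart (complexmx M) = M.
Proof. by apply/matrixP => i j; rewrite !mxE. Qed.

Lemma ipart_complexmx m n (M : 'M[R]_(m, n)) : ipart (complexmx M) = 0.
Proof. by apply/matrixP => i j; rewrite !mxE. Qed.

Lemma reimE m n (u : 'M[C]_(m, n)) :
  u = complexmx (rpart u) + 'i *: complexmx (ipart u).
Proof.
apply/matrixP => i j; rewrite !mxE; case: (u i j) => a b.
by apply/eqP; rewrite eq_complex /=; apply/andP; split; apply/eqP; ring.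
Qed.

Lemma rpart_mul m n p (M : 'M[R]_(m, n)) (v : 'M[C]_(n, p)) :
  rpart (complexmx M *m v) = M *m rpart v.
Proof.
rewrite {1}[v]reimE mulmxDr -scalemxAr -!complexmxM rpartD rpartZ /=.
by rewrite !rpart_complexmx ipart_complexmx scale0r scaler0 subr0 addr0.
Qed.

Lemma ipart_mul m n p (M : 'M[R]_(m, n)) (v : 'M[C]_(n, p)) :
  ipart (complexmx M *m v) = M *m ipart v.
Proof.
rewrite {1}[v]reimE mulmxDr -scalemxAr -!complexmxM ipartD ipartZ /=.
by rewrite !rpart_complexmx !ipart_complexmx scaler0 !add0r scale1r.
Qed.

Lemma normc_sqr (z : C) : Normc.normc z ^+ 2 = complex.Re z ^+ 2 + complex.Im z ^+ 2.
Proof. by case: z => a b /=; rewrite sqr_sqrtr // addr_ge0 ?sqr_ge0. Qed.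

(** The cross terms between real and imaginary parts cancel by symmetry. *)
Lemma cquadZ n (P : 'M[R]_n) (a : C) v : P^T = P ->
  cquad P (a *: v) = Normc.normc a ^+ 2 * cquad P v.
Proof.
move=> sP; rewrite /cquad rpartZ ipartZ !quadD // quadN !quadZ.
rewrite mulmxN dotNr -!scalemxAr !dotZl !dotZr (dot_adj P (ipart v)) sP.
by rewrite (dotC (_ *m ipart v)) normc_sqr; ring.
Qed.

Lemma cquad1 n (v : 'cV[C]_n) : cquad 1%:M v = csqn v.
Proof. by rewrite /csqn !sqn_quad1. Qed.

Lemma csqn_complexmx n (x : 'cV[R]_n) : csqn (complexmx x) = sqn x.
Proof. by rewrite /csqn rpart_complexmx ipart_complexmx sqn0 addr0. Qed.

Lemma csqn_ge0 n (v : 'cV[C]_n) : 0 <= csqn v.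
Proof. by rewrite addr_ge0 ?sqn_ge0. Qed.

Lemma cnorm_sqr n (v : 'cV[C]_n) : cnorm v ^+ 2 = csqn v.
Proof. by rewrite sqr_sqrtr ?csqn_ge0. Qed.

Lemma cnorm_ge0 n (v : 'cV[C]_n) : 0 <= cnorm v.
Proof. exact: sqrtr_ge0. Qed.

Lemma csqn_eq0 n (v : 'cV[C]_n) : csqn v = 0 -> v = 0.
Proof.
move/eqP; rewrite paddr_eq0 ?sqn_ge0 // => /andP[/eqP hr /eqP hi].
by apply: reim_eq0; apply: sqn_eq0.
Qed.

Lemma cnorm_gt0 n (v : 'cV[C]_n) : v != 0 -> 0 < cnorm v.
Proof.
move=> v0; rewrite sqrtr_gt0 lt_def csqn_ge0 andbT.
by apply: contra_neq v0 => /csqn_eq0.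
Qed.

Lemma cnorm0 n : cnorm (0 : 'cV[C]_n) = 0.
Proof.
rewrite /cnorm -(scale0r 0) -cquad1 cquadZ ?trmx1 // normc_sqr /= expr0n.
by rewrite addr0 mul0r sqrtr0.
Qed.

Lemma cnormZ n (a : C) (v : 'cV[C]_n) : cnorm (a *: v) = Normc.normc a * cnorm v.
Proof.
have a0 : 0 <= Normc.normc a by case: (a) => x y /=; exact: sqrtr_ge0.
rewrite /cnorm -!cquad1 cquadZ ?trmx1 // sqrtrM ?sqr_ge0 // sqrtr_sqr.
by rewrite ger0_norm.
Qed.

Lemma normcR (a : R) : Normc.normc a%:C = `|a|.
Proof. by rewrite /= expr0n addr0 sqrtr_sqr. Qed.

Lemma cnormN n (v : 'cV[C]_n) : cnorm (- v) = cnorm v.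
Proof.
have -> : - v = (-1 : R)%:C *: v by rewrite rmorphN scaleN1r.
by rewrite cnormZ normcR normrN1 mul1r.
Qed.

Lemma cnormD n (u v : 'cV[C]_n) : cnorm (u + v) <= cnorm u + cnorm v.
Proof.
rewrite /cnorm /csqn -!sqn_col_mx rpartD ipartD -add_col_mx.
exact: sqrt_sqn_triangle.
Qed.

Lemma cnormZ_ge0 n (a : R) (u : 'cV[C]_n) : 0 <= a -> cnorm (a%:C *: u) = a * cnorm u.
Proof. by move=> a0; rewrite cnormZ normcR ger0_norm. Qed.

Lemma cnorm_comb n (a b : R) (u v : 'cV[C]_n) : 0 <= a -> 0 <= b ->
  cnorm (a%:C *: u + b%:C *: v) <= a * cnorm u + b * cnorm v.
Proof. by move=> a0 b0; rewrite -!cnormZ_ge0 ?cnormD. Qed.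

Lemma cnormB n (u v : 'cV[C]_n) : cnorm (u - v) <= cnorm u + cnorm v.
Proof. by rewrite -(cnormN v) cnormD. Qed.

(** A crude constant, but proportional to [`|M|], which is what estimates uniform
    in a matrix variable require. *)
Lemma sqn_mul_le m n (M : 'M[R]_(m, n)) x :
  sqn (M *m x) <= (m%:R * n%:R * `|M|) ^+ 2 * sqn x.
Proof.
have hn : 0 <= Num.sqrt (sqn x) := sqrtr_ge0 _.
have hx j : `|x j 0| <= Num.sqrt (sqn x).
  rewrite -sqrtr_sqr ler_sqrt ?sqn_ge0 // sqnE (bigD1 j) //= lerDl.
  by apply: sumr_ge0 => i _; apply: sqr_ge0.
have hM i j : `|M i j| <= `|M|.
  rewrite [leRHS]/Num.norm /= mx_normrE.
  exact: (@le_bigmax _ R _ 0 (fun ij : 'I_m * 'I_n => `|M ij.1 ij.2|) (i, j)).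
have hr i : (M *m x) i 0 ^+ 2 <= (n%:R * `|M| * Num.sqrt (sqn x)) ^+ 2.
  rewrite -(real_normK (num_real ((M *m x) i 0))) ler_sqr ?nnegrE ?mulr_ge0 // mxE.
  apply: le_trans (ler_norm_sum _ _ _) _.
  have -> : n%:R * `|M| * Num.sqrt (sqn x) = \sum_(j < n) `|M| * Num.sqrt (sqn x).
    by rewrite sumr_const card_ord -mulrA mulr_natl.
  by apply: ler_sum => j _; rewrite normrM ler_pM.
rewrite sqnE; apply: le_trans (ler_sum _ (fun i _ => hr i)) _.
rewrite sumr_const card_ord -[leLHS]mulr_natl !exprMn sqr_sqrtr ?sqn_ge0 //.
rewrite !mulrA ler_wpM2r ?sqn_ge0 // ler_wpM2r ?sqr_ge0 // ler_wpM2r ?sqr_ge0 //.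
by rewrite !ler_wpM2r // -natrX ler_nat; case: (m) => // k; rewrite -mulnn leq_pmulr.
Qed.

Lemma cnorm_mul_le m n (M : 'M[R]_(m, n)) (v : 'cV[C]_n) :
  cnorm (complexmx M *m v) <= m%:R * n%:R * `|M| * cnorm v.
Proof.
have k0 : 0 <= m%:R * n%:R * `|M| by rewrite !mulr_ge0.
rewrite /cnorm -[m%:R * _ * _]ger0_norm // -sqrtr_sqr -sqrtrM ?sqr_ge0 //.
rewrite ler_sqrt ?mulr_ge0 ?sqr_ge0 ?csqn_ge0 // /csqn rpart_mul ipart_mul mulrDr.
by rewrite lerD ?sqn_mul_le.
Qed.

Lemma complexmx_bounded m n (M : 'M[R]_(m, n)) : exists2 b : R, 0 <= b &
  forall v : 'cV[C]_n, cnorm (complexmx M *m v) <= b * cnorm v.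
Proof.
exists (m%:R * n%:R * `|M|) => [|v]; first by rewrite !mulr_ge0.
exact: cnorm_mul_le.
Qed.

Lemma complexmxZ_mul m n p (a : R) (M : 'M[R]_(m, n)) (v : 'M[C]_(n, p)) :
  complexmx (a *: M) *m v = a%:C *: (complexmx M *m v).
Proof. by rewrite complexmxZ scalemxAl. Qed.

Lemma realcB (a b : R) : (a - b)%:C = a%:C - b%:C :> C.
Proof. exact: (rmorphB (real_complex R)). Qed.

Lemma realcM (a b : R) : (a * b)%:C = a%:C * b%:C :> C.
Proof. exact: (rmorphM (real_complex R)). Qed.

End ComplexVectors.

(** * Hermitian matrices, the largest singular value and square roots *)

Section Hermitian.
Variable R : realType.
Local Notation C := R[i].

Lemma mulC_conj (z : C) : Num.conj z * z = (Normc.normc z ^+ 2)%:C.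
Proof.
rewrite normc_sqr; case: z => a b /=.
by apply/eqP; rewrite eq_complex /=; apply/andP; split; apply/eqP; ring.
Qed.

Lemma csqn_sum n (v : 'cV[C]_n) : csqn v = \sum_i Normc.normc (v i 0) ^+ 2.
Proof.
rewrite /csqn !sqnE -big_split; apply: eq_bigr => i _ /=.
by rewrite !mxE normc_sqr.
Qed.

Lemma csqnE n (v : 'cV[C]_n) : (csqn v)%:C = (v^t* *m v) 0 0.
Proof.
rewrite csqn_sum rmorph_sum /= mxE; apply: eq_bigr => i _.
by rewrite !mxE mulC_conj.
Qed.

Lemma ctmxM m n p (M : 'M[C]_(m, n)) (N : 'M[C]_(n, p)) :
  (M *m N)^t* = N^t* *m M^t*.
Proof. by rewrite trmx_mul map_mxM. Qed.

Lemma ctmx_complexmx m n (M : 'M[R]_(m, n)) :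
  (complexmx M)^t* = complexmx M^T.
Proof.
apply/matrixP => i j; rewrite !mxE.
by apply/eqP; rewrite eq_complex /= oppr0 !eqxx.
Qed.

Lemma csqn_mul m n (M : 'M[C]_(m, n)) (v : 'cV[C]_n) :
  (csqn (M *m v))%:C = (v^t* *m (M^t* *m M) *m v) 0 0.
Proof. by rewrite csqnE ctmxM !mulmxA. Qed.

Lemma hermitian_spectral n (H : 'M[C]_n) : H^t* = H ->
  exists U : 'M[C]_n, exists d : 'I_n -> R,
  [/\ U^t* *m U = 1%:M, U *m U^t* = 1%:M
    & H = U^t* *m diag_mx (\row_i (d i)%:C) *m U].
Proof.
move=> hH; have hh : H \is hermsymmx.
  by apply/is_hermitianmxP; rewrite expr0 scale1r -{1}hH.
have nH := hermitian_normalmx hh.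
have uU := spectral_unitarymx H.
exists (spectralmx H), (fun i => complex.Re (spectral_diag H 0 i)); split.
- by rewrite -invmx_unitary // mulVmx // spectral_unit.
- exact/unitarymxP.
- rewrite -invmx_unitary // {1}(orthomx_spectralP nH).
  congr (_ *m diag_mx _ *m _); apply/rowP => i; rewrite mxE RRe_real //.
  by have /mxOverP := hermitian_spectral_diag_real hh; apply.
Qed.

(** Left and right eigenvalues coincide because [M - l] and its transpose are
    singular together. *)
Lemma eigenvalue_colP n (M : 'M[C]_n) (l : C) :
  reflect (exists2 v : 'cV[C]_n, v != 0 & M *m v = l *: v) (eigenvalue M l).
Proof.
have eqT : eigenvalue M l = eigenvalue M^T l.
  rewrite /eigenvalue /eigenspace !kermx_eq0 !row_free_unit -(unitmx_tr (M - _)).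
  by rewrite linearB /= tr_scalar_mx.
rewrite eqT; apply: (iffP eigenvalueP) => [[v hv v0]|[v v0 hv]].
- exists v^T; first by rewrite -(inj_eq (@trmx_inj _ _ _)) trmxK trmx0.
  by apply: trmx_inj; rewrite trmx_mul trmxK hv linearZ /= trmxK.
- exists v^T; last by rewrite -(inj_eq (@trmx_inj _ _ _)) trmxK trmx0.
  by rewrite -trmx_mul hv linearZ.
Qed.

Lemma quad_diag n (d : 'I_n -> R) (y : 'cV[C]_n) :
  (y^t* *m diag_mx (\row_i (d i)%:C) *m y) 0 0
    = (\sum_i d i * Normc.normc (y i 0) ^+ 2)%:C.
Proof.
rewrite -mulmxA mul_diag_mx mxE rmorph_sum /=; apply: eq_bigr => i _.
by rewrite !mxE mulrCA mulC_conj -rmorphM.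
Qed.

Lemma csqn_unitary n (U : 'M[C]_n) (v : 'cV[C]_n) :
  U^t* *m U = 1%:M -> csqn (U *m v) = csqn v.
Proof.
by move=> hU; apply: complexI; rewrite csqn_mul hU mulmx1 csqnE.
Qed.

(** In an orthonormal eigenbasis of [M^* M] the map [v |-> |M v|^2] is a weighted
    sum of squares, whose weights are squared singular values. *)
Lemma csqn_mul_spectral m n (M : 'M[C]_(m, n)) :
  exists U : 'M[C]_n, exists d : 'I_n -> R,
  [/\ U^t* *m U = 1%:M,
      forall i, 0 <= d i /\ eigenvalue (M^t* *m M) (d i)%:C
    & forall v, csqn (M *m v) = \sum_i d i * Normc.normc ((U *m v) i 0) ^+ 2].
Proof.
have [|U [d [hU hU' hM]]] := @hermitian_spectral _ (M^t* *m M).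
  by rewrite ctmxM trmxCK.
have hq v : csqn (M *m v) = \sum_i d i * Normc.normc ((U *m v) i 0) ^+ 2.
  by apply: complexI; rewrite csqn_mul hM -quad_diag ctmxM !mulmxA.
exists U, d; split=> // i.
pose v : 'cV[C]_n := U^t* *m delta_mx i 0.
have Uv : U *m v = delta_mx i 0 by rewrite mulmxA hU' mul1mx.
split.
  have := csqn_ge0 (M *m v); rewrite hq Uv (bigD1 i) //= big1 => [|j ji].
    by rewrite mxE !eqxx /= expr1n addr0 expr0n addr0 sqrtr1 expr1n mulr1.
  by rewrite mxE (negPf ji) /= expr0n addr0 sqrtr0 expr0n mulr0.
apply/eigenvalue_colP; exists v.
  apply/eqP => v0; move: Uv; rewrite v0 mulmx0 => /matrixP /(_ i 0).
  by rewrite !mxE !eqxx => /eqP; rewrite eq_sym oner_eq0.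
rewrite hM -[LHS]mulmxA Uv -mulmxA mul_diag_mx scalemxAr; congr (_ *m _).
by apply/matrixP => j k; rewrite !mxE ord1; case: eqP => [->|]; rewrite ?mulr0.
Qed.

Lemma singular_value_le m n (M : 'M[C]_(m, n)) c : 0 <= c ->
  (forall v, cnorm (M *m v) <= c * cnorm v) -> ubound (singular_values M) c.
Proof.
move=> c0 hc s [s0 /eigenvalue_colP[v v0 hv]].
have cv : csqn (M *m v) = s ^+ 2 * csqn v.
  by apply: complexI; rewrite csqn_mul -mulmxA hv -scalemxAr mxE -csqnE -rmorphM.
have := hc v; rewrite /cnorm cv sqrtrM ?sqr_ge0 // sqrtr_sqr ger0_norm //.
by rewrite ler_pM2r // cnorm_gt0.
Qed.

(** Together with [sigma_max_bound] this identifies the largest singular value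
    with the operator norm, the only form in which it is used below. *)
Lemma sigma_max_le m n (M : 'M[C]_(m, n)) c : 0 <= c ->
  (forall v, cnorm (M *m v) <= c * cnorm v) -> sigma_max M <= c.
Proof.
move=> c0 hc; have [h0|/set0P h0] := eqVneq (singular_values M) set0.
  by rewrite /sigma_max h0 sup0.
exact: ge_sup h0 (singular_value_le c0 hc).
Qed.

Lemma sigma_max_bound m n (M : 'M[C]_(m, n)) v :
  0 <= sigma_max M /\ cnorm (M *m v) <= sigma_max M * cnorm v.
Proof.
have [U [d [hU hd hM]]] := csqn_mul_spectral M.
have ub : has_ubound (singular_values M).
  exists (Num.sqrt (\sum_i d i)); apply: singular_value_le => [|w].
    exact: sqrtr_ge0.
  have s0 : 0 <= \sum_i d i by apply: sumr_ge0 => i _; case: (hd i).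
  rewrite -sqrtrM // ler_sqrt ?mulr_ge0 ?csqn_ge0 // hM mulr_suml.
  apply: ler_sum => i _; rewrite ler_wpM2l //; first by case: (hd i).
  rewrite -(csqn_unitary w hU) csqn_sum (bigD1 i) //= lerDl.
  by apply: sumr_ge0 => j _; apply: sqr_ge0.
have hs i : Num.sqrt (d i) <= sigma_max M.
  have [d0 di] := hd i.
  apply: (ub_le_sup ub); split; first exact: sqrtr_ge0.
  by rewrite (sqr_sqrtr d0).
have s0 : 0 <= sigma_max M.
  have [h0|/set0P[s sM]] := eqVneq (singular_values M) set0.
    by rewrite /sigma_max h0 sup0.
  by apply: le_trans (ub_le_sup ub sM); case: sM.
split=> //.
rewrite -[sigma_max M]ger0_norm // -sqrtr_sqr -sqrtrM ?sqr_ge0 //.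
rewrite ler_sqrt ?mulr_ge0 ?sqr_ge0 ?csqn_ge0 // hM -(csqn_unitary v hU).
rewrite csqn_sum mulr_sumr; apply: ler_sum => i _.
have [d0 _] := hd i; rewrite ler_wpM2r ?sqr_ge0 //.
by rewrite -(sqr_sqrtr d0) ler_sqr ?nnegrE ?sqrtr_ge0.
Qed.

(** Repeated nodes are allowed, since the nodes will be eigenvalues listed with
    multiplicity. *)
Lemma interpolation (I : eqType) (s : seq I) (x f : I -> R) :
  (forall i j, x i = x j -> f i = f j) ->
  exists p : {poly R}, forall i, i \in s -> p.[x i] = f i.
Proof.
move=> xf; elim: s => [|a s [p hp]]; first by exists 0.
have [/hasP[b bs /eqP xab]|/hasPn xa] := boolP (has (fun b => x b == x a) s).
  exists p => i; rewrite inE => /predU1P[->|/hp//].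
  by rewrite -xab hp //; apply: xf.
pose q := \prod_(b <- s) ('X - (x b)%:P).
have qa : q.[x a] != 0.
  rewrite /q horner_prod prodf_seq_neq0; apply/allP => b bs /=.
  by rewrite hornerXsubC subr_eq0 eq_sym; apply: xa.
exists (p + ((f a - p.[x a]) / q.[x a]) *: q) => i.
rewrite inE hornerD hornerZ => /predU1P[->|is_].
  by rewrite divfK // addrC subrK.
have -> : q.[x i] = 0.
  apply/eqP; rewrite /q horner_prod prodf_seq_eq0; apply/hasP; exists i => //=.
  by rewrite hornerXsubC subrr.
by rewrite mulr0 addr0 hp.
Qed.

Lemma complexmx_quad n (P : 'M[R]_n) (x : 'cV[R]_n) :
  (quad P x)%:C = ((complexmx x)^t* *m complexmx P *m complexmx x) 0 0.
Proof. by rewrite ctmx_complexmx -!complexmxM mxE -quadE. Qed.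

(** The spectral theorem only provides a complex square root. Taking instead
    [p(M)], with [p] a real polynomial that interpolates the square root on the
    spectrum of [M], gives a real one. *)
Lemma psd_sqrt_exists n (M : 'M[R]_n) : positive_definite M ->
  exists S : 'M[R]_n, positive_semidefinite S /\ S *m S = M.
Proof.
case: n M => [|n] M pM.
  exists 0; split; last by rewrite mulmx0 [M]flatmx0.
  by split=> [|x]; rewrite ?trmx0 // quadE /quad mul0mx /dot mulmx0 mxE.
case: (pM) => sM _.
have [|U [d [hU hU' hM]]] := @hermitian_spectral _ (complexmx M).
  by rewrite ctmx_complexmx sM.
have uU : U \in unitmx by case/mulmx1_unit: hU'.
have iU : invmx U = U^t*.
  by rewrite -[LHS]mul1mx -hU mulmxK.
have d0 i : 0 <= d i.
  pose v : 'cV[C]_n.+1 := U^t* *m delta_mx i 0.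
  have Uv : U *m v = delta_mx i 0 by rewrite mulmxA hU' mul1mx.
  have v0 : v != 0.
    apply/eqP => v0; move: Uv; rewrite v0 mulmx0 => /matrixP /(_ i 0).
    by rewrite !mxE !eqxx => /eqP; rewrite eq_sym oner_eq0.
  have Mv : complexmx M *m v = (d i)%:C *: v.
    rewrite hM -[LHS]mulmxA Uv -mulmxA mul_diag_mx scalemxAr; congr (_ *m _).
    by apply/matrixP => j k; rewrite !mxE ord1; case: eqP => [->|]; rewrite ?mulr0.
  have hq : cquad M v = d i * csqn v.
    rewrite /cquad /quad -rpart_mul -ipart_mul Mv rpartZ ipartZ /=.
    by rewrite !scale0r subr0 addr0 !dotZr -mulrDr.
  have := posdef_quad_ge0 pM (ipart v); have := posdef_quad_ge0 pM (rpart v).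
  move=> h1 h2; have := addr_ge0 h1 h2; rewrite -/(cquad M v) hq.
  by rewrite pmulr_lge0 // -cnorm_sqr exprn_gt0 // cnorm_gt0.
have [p hp] := @interpolation _ (index_enum 'I_n.+1) d (fun i => Num.sqrt (d i))
  (fun i j h => congr1 _ h).
pose S := horner_mx M p.
pose D := diag_mx (\row_i (Num.sqrt (d i))%:C).
have hS : complexmx S = U^t* *m D *m U.
  rewrite /complexmx (map_horner_mx (real_complex R)) -/(complexmx M) hM -iU.
  have := @horner_mx_uconj _ _ (map_poly (real_complex R) p) (invmx U)
     (diag_mx (\row_i (d i)%:C)).
  rewrite invmxK => -> //; last by rewrite unitmx_inv.
  rewrite horner_mx_diag; congr (_ *m diag_mx _ *m _).
  apply/rowP => i; rewrite !mxE (horner_map (real_complex R)) /=.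
  by rewrite hp // mem_index_enum.
exists S; split; first split.
- apply: complexmx_inj; rewrite -ctmx_complexmx hS !ctmxM trmxCK mulmxA.
  congr (_ *m _ *m _); rewrite /D tr_diag_mx map_diag_mx; congr diag_mx.
  apply/rowP => i; rewrite !mxE.
  by apply/eqP; rewrite eq_complex /= oppr0 !eqxx.
- move=> x; rewrite quadE.
  have : (0 : C) <= (quad S x)%:C.
    rewrite complexmx_quad hS.
    have -> : (complexmx x)^t* *m (U^t* *m D *m U) *m complexmx x =
       (U *m complexmx x)^t* *m D *m (U *m complexmx x).
      by rewrite ctmxM !mulmxA.
    rewrite quad_diag ler0c sumr_ge0 // => i _.
    by rewrite mulr_ge0 ?sqrtr_ge0 ?sqr_ge0.
  by rewrite ler0c.
- apply: complexmx_inj; rewrite complexmxM hS hM.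
  rewrite !mulmxA -[_ *m U *m U^t*]mulmxA hU' mulmx1 -[_ *m D *m D]mulmxA.
  congr (_ *m _ *m _); rewrite /D mulmx_diag; congr diag_mx.
  by apply/rowP => i; rewrite !mxE -rmorphM /= -expr2 sqr_sqrtr.
Qed.

Lemma psd_sqrtP n (M : 'M[R]_n) (x : 'cV[R]_n) : positive_definite M ->
  sqn (psd_sqrt M *m x) = quad M x.
Proof.
move=> /psd_sqrt_exists[S hS]; rewrite sqn_mul.
have [[sS _] S2] := @xgetPex _ 0 [set S | positive_semidefinite S /\ S *m S = M]
  (ex_intro _ S hS).
by rewrite sS S2.
Qed.

End Hermitian.

(** * Schur stability *)

Section Stability.
Variable R : realType.
Local Notation C := R[i].

Lemma normc_ge0 (z : C) : 0 <= Normc.normc z.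
Proof. by case: z => a b /=; exact: sqrtr_ge0. Qed.

Lemma eigenvalue_roots n (M : 'M[C]_n) : exists rs : seq C,
  char_poly M = \prod_(r <- rs) ('X - r%:P) /\ forall l, (l \in rs) = eigenvalue M l.
Proof.
have [rs] := closed_field_poly_normal (char_poly M).
rewrite (eqP (char_poly_monic M)) scale1r => h; exists rs; split=> // l.
by rewrite eigenvalue_root_char h root_prod_XsubC.
Qed.

Lemma spectral_radius_lt1P n (M : 'M[R]_n) :
  spectral_radius M < 1 <->
  forall l, eigenvalue (complexmx M) l -> Normc.normc l < 1.
Proof.
have [rs [_ hrs]] := eigenvalue_roots (complexmx M).
set E := [set Normc.normc l | l in [set l : C | eigenvalue (complexmx M) l]].
pose c := \big[Num.max/0]_(r <- rs) Normc.normc r.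
have hc : ubound E c.
  by move=> _ [l /= hl <-]; apply: le_bigmax_seq => //; rewrite hrs.
split=> [h l hl|h].
  by apply: le_lt_trans h; apply: ub_le_sup; [exists c|exists l].
rewrite /spectral_radius -/E; have [->|/set0P E0] := eqVneq E set0.
  by rewrite sup0 ltr01.
apply: le_lt_trans (ge_sup E0 hc) _; rewrite /c big_seq.
by apply: bigmax_lt => // r; rewrite hrs => /h.
Qed.

Lemma iter_mulmxD n (A : 'M[C]_n) k (u v : 'cV[C]_n) :
  iter k (mulmx A) (u + v) = iter k (mulmx A) u + iter k (mulmx A) v.
Proof. by elim: k => //= k ->; rewrite mulmxDr. Qed.

Lemma iter_mulmxZ n (A : 'M[C]_n) k a (v : 'cV[C]_n) :
  iter k (mulmx A) (a *: v) = a *: iter k (mulmx A) v.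
Proof. by elim: k => //= k ->; rewrite scalemxAr. Qed.

Lemma horner_mx_prod_XsubC n (A : 'M[C]_n.+1) (rs : seq C) (v : 'cV[C]_n.+1) :
  horner_mx A (\prod_(r <- rs) ('X - r%:P)) *m v
    = foldl (fun w r => A *m w - r *: w) v rs.
Proof.
elim: rs v => [|r rs IH] v; first by rewrite big_nil rmorph1 mul1mx.
rewrite big_cons mulrC rmorphM rmorphB /= horner_mx_X horner_mx_C -mulmxA.
by rewrite mulmxBl mul_scalar_mx IH.
Qed.

(** With [u = A v - r v] one has [A^(i+1) v = r A^i v + A^i u], so a partial sum
    [S] of the norms along the orbit of [v] satisfies [S <= |v| + |r| S + S'], with
    [S'] the same sum for [u]. As [|r| < 1], a bound for [u] gives one for [v], and
    the factors [A - r] can be peeled off one at a time. *)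
Lemma orbit_sum_bound n (A : 'M[R]_n) (rs : seq C) :
  (forall r, r \in rs -> Normc.normc r < 1) ->
  exists2 m : R, 0 <= m & forall v : 'cV[C]_n,
    foldl (fun w r => complexmx A *m w - r *: w) v rs = 0 -> forall k,
    \sum_(i < k) cnorm (iter i (mulmx (complexmx A)) v) <= m * cnorm v.
Proof.
elim: rs => [|r rs IH] hr.
  exists 0 => // v /= -> k; rewrite mul0r big1 // => i _.
  by rewrite -(scale0r 0) iter_mulmxZ !scale0r cnorm0.
have [|m m0 hm] := IH; first by move=> s srs; apply: hr; rewrite inE srs orbT.
have r1 : Normc.normc r < 1 by apply: hr; rewrite mem_head.
have r0 := normc_ge0 r.
pose a := n%:R * n%:R * `|A|.
have a0 : 0 <= a by rewrite !mulr_ge0.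
exists ((1 + m * (a + 1)) / (1 - Normc.normc r)) => [|v /= hv k].
  apply: divr_ge0; last by rewrite subr_ge0 ltW.
  by rewrite addr_ge0 ?mulr_ge0 ?addr_ge0.
set u := complexmx A *m v - r *: v in hv.
have u_le : cnorm u <= (a + 1) * cnorm v.
  apply: le_trans (cnormB _ _) _; rewrite mulrDl cnormZ lerD ?cnorm_mul_le //.
  by rewrite ler_wpM2r ?cnorm_ge0 // ltW.
have step i : cnorm (iter i.+1 (mulmx (complexmx A)) v) <=
    Normc.normc r * cnorm (iter i (mulmx (complexmx A)) v)
      + cnorm (iter i (mulmx (complexmx A)) u).
  rewrite -cnormZ -iter_mulmxZ iterSr.
  have -> : complexmx A *m v = r *: v + u by rewrite addrC subrK.
  by rewrite iter_mulmxD cnormD.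
set S := \sum_(i < k) _.
have S_le : S <= cnorm v + Normc.normc r * S + m * ((a + 1) * cnorm v).
  apply: (@le_trans _ _ (\sum_(i < k.+1) cnorm (iter i (mulmx (complexmx A)) v))).
    by rewrite big_ord_recr /= lerDl cnorm_ge0.
  rewrite big_ord_recl /= -addrA lerD2l.
  have /le_trans := ler_sum (index_enum 'I_k) (fun (i : 'I_k) (_ : true) => step i).
  apply; rewrite big_split /= -mulr_sumr lerD2l.
  by apply: le_trans (hm _ hv k) _; rewrite ler_wpM2l.
rewrite mulrAC ler_pdivlMr ?subr_gt0 //; lra.
Qed.

(** By Cayley-Hamilton, the factors [A - r] of the characteristic polynomial
    compose to zero. *)
Lemma stable_orbit_sum n (A : 'M[R]_n) : spectral_radius A < 1 ->
  exists2 m : R, 0 < m & forall (v : 'cV[C]_n) k,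
    \sum_(i < k) cnorm (iter i (mulmx (complexmx A)) v) <= m * cnorm v.
Proof.
case: n A => [|n] A; move=> /spectral_radius_lt1P hA.
  exists 1 => // v k; rewrite mul1r big1 ?cnorm_ge0 // => i _.
  by rewrite [iter _ _ _]flatmx0 cnorm0.
have [rs [hc hrs]] := eigenvalue_roots (complexmx A).
have [|m m0 hm] := @orbit_sum_bound _ A rs.
  by move=> r; rewrite hrs; apply: hA.
exists (m + 1) => [|v k]; first by rewrite ltr_wpDl.
apply: (@le_trans _ _ (m * cnorm v)); last first.
  by rewrite ler_wpM2r ?cnorm_ge0 // lerDl ler01.
by apply: hm; rewrite -horner_mx_prod_XsubC -hc Cayley_Hamilton mul0mx.
Qed.

(** An a priori estimate of the resolvent of [A] on and outside the unit circle.
    It mentions no inverse, so it survives perturbation and implies stability. *)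
Definition resolvent_bound n (A : 'M[R]_n) (m : R) := forall (z : C) (x : 'cV[C]_n),
  1 <= Normc.normc z -> cnorm x <= m * cnorm (z *: x - complexmx A *m x).

Lemma le_of_natmul (a b : R) : (forall k : nat, k%:R * a <= b) -> a <= 0.
Proof.
move=> h; rewrite leNgt; apply/negP => a0.
have := h (Num.truncn (b / a)).+1; rewrite -ler_pdivlMr // leNgt.
by rewrite truncnS_gt.
Qed.

Lemma stable_orbit_small n (A : 'M[R]_n) (v : 'cV[C]_n) (e : R) :
  spectral_radius A < 1 -> 0 < e ->
  exists k, cnorm (iter k (mulmx (complexmx A)) v) < e.
Proof.
move=> /stable_orbit_sum[m m0 hm] e0; apply: contrapT => h.
have : e <= 0; last by rewrite leNgt e0.
apply: (@le_of_natmul _ (m * cnorm v)) => k; apply: le_trans (hm v k).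
rewrite mulr_natl -[X in _ *+ X]card_ord -sumr_const; apply: ler_sum => i _.
by rewrite leNgt; apply/negP => hi; apply: h; exists i.
Qed.

(** Since [|z| >= 1], [|A^k x| <= |A^(k+1) x| + |A^k b|] with [b = z x - A x];
    telescoping leaves the summable orbit of [b] and a remainder [|A^k x|] that is
    small for some [k]. *)
Lemma stable_resolvent n (A : 'M[R]_n) : spectral_radius A < 1 ->
  exists2 m : R, 0 < m & resolvent_bound A m.
Proof.
move=> /[dup] sA /stable_orbit_sum[m m0 hm]; exists m => // z x z1.
set b := z *: x - _.
have step k : cnorm x <= cnorm (iter k (mulmx (complexmx A)) x)
    + \sum_(i < k) cnorm (iter i (mulmx (complexmx A)) b).
  elim: k => [|k IH]; first by rewrite big_ord0 addr0.
  have h : cnorm (iter k (mulmx (complexmx A)) x) <=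
      cnorm (iter k.+1 (mulmx (complexmx A)) x) + cnorm (iter k (mulmx (complexmx A)) b).
    apply: (@le_trans _ _ (Normc.normc z * cnorm (iter k (mulmx (complexmx A)) x))).
      by rewrite ler_peMl ?cnorm_ge0.
    rewrite -cnormZ -iter_mulmxZ iterSr.
    have -> : z *: x = complexmx A *m x + b by rewrite addrC subrK.
    by rewrite iter_mulmxD cnormD.
  by rewrite big_ord_recr /=; move: h => /=; lra.
rewrite -subr_le0; apply/ler_addgt0Pr => e e0; rewrite add0r.
have [k hk] := stable_orbit_small x sA e0.
rewrite lerBlDr; apply: le_trans (step k) _.
by rewrite lerD // ltW.
Qed.

Lemma resolvent_stable n (A : 'M[R]_n) m :
  resolvent_bound A m -> spectral_radius A < 1.
Proof.
move=> hm; apply/spectral_radius_lt1P => l /eigenvalue_colP[v v0 hv].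
rewrite ltNge; apply/negP => l1; have := hm l v l1.
by rewrite hv subrr cnorm0 mulr0 leNgt cnorm_gt0.
Qed.

Lemma resolvent_perturb n (A E : 'M[R]_n) m : 0 < m ->
  resolvent_bound A m ->
  (forall x, m * cnorm (complexmx E *m x) <= 2^-1 * cnorm x) ->
  resolvent_bound (A + E) (2 * m).
Proof.
move=> m0 hm hE z x z1; have h := hm z x z1.
set b := z *: x - _ *m x.
have e : z *: x - complexmx A *m x = b + complexmx E *m x.
  by rewrite /b complexmxD mulmxDl opprD addrA subrK.
have h1 := hE x.
have h2 : cnorm x <= m * cnorm b + m * cnorm (complexmx E *m x).
  by rewrite -mulrDr; apply: le_trans h _; rewrite ler_pM2l // e cnormD.
rewrite -mulrA; move: h1 h2; clear.
move: (m * cnorm b) (m * cnorm _) (cnorm x) => p q r; lra.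
Qed.

Lemma stable_unitmx n (A : 'M[R]_n) (z : C) : spectral_radius A < 1 ->
  1 <= Normc.normc z -> z%:M - complexmx A \in unitmx.
Proof.
move=> /spectral_radius_lt1P hA z1; apply: contraTT z1 => nu.
rewrite -ltNge; apply: hA.
rewrite /eigenvalue /eigenspace kermx_eq0 row_free_unit.
by rewrite -opprB -scaleN1r unitmxZ // unitrN1.
Qed.

End Stability.

(** * The H-infinity cost *)

Lemma subr_interchange (V : zmodType) (a b c d : V) :
  a - b - (c - d) = a - c - (b - d).
Proof. by rewrite !opprD addrACA. Qed.

Lemma eq_le_r (R : realType) (a b : R) : a = b -> a <= b.
Proof. by move=> ->. Qed.

Section Cost.
Variables (R : realType) (nx nu nw : nat).
Variables (A : 'M[R]_nx) (B : 'M[R]_(nx, nu)) (Bw : 'M[R]_(nx, nw)).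
Variables (Q : 'M[R]_nx) (Ru : 'M[R]_nu).
Local Notation C := R[i].
Local Notation J := (hinf_cost A B Bw Q Ru).
Local Notation T := (Tzw A B Bw Q Ru).
Local Notation stab := (stabilizing_gains A B).

Lemma normc_cexpi (w : R) : Normc.normc (cexpi w) = 1.
Proof. by rewrite /= cos2Dsin2 sqrtr1. Qed.

(** The complex amplitude of the closed-loop state driven at frequency [w]. *)
Definition cl_state (K : 'M[R]_(nu, nx)) (w : R) (v : 'cV[C]_nw) : 'cV[C]_nx :=
  invmx ((cexpi w)%:M - complexmx (A + B *m K)) *m (complexmx Bw *m v).

Definition cl_output (K : 'M[R]_(nu, nx)) : 'M[R]_(nx + nu, nx) :=
  col_mx (psd_sqrt Q) (psd_sqrt Ru *m K).

Definition cl_res (K : 'M[R]_(nu, nx)) (w : R) (x : 'cV[C]_nx) : 'cV[C]_nx :=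
  cexpi w *: x - complexmx (A + B *m K) *m x.

Lemma cl_resB K w x y : cl_res K w (x - y) = cl_res K w x - cl_res K w y.
Proof. by rewrite /cl_res scalerBr mulmxBr subr_interchange. Qed.

Lemma cl_resZ K w a x : cl_res K w (a *: x) = a *: cl_res K w x.
Proof. by rewrite /cl_res scalerBr -scalemxAr !scalerA mulrC. Qed.

Lemma cl_res_shift K D w x :
  cl_res (K + D) w x = cl_res K w x - complexmx (B *m D) *m x.
Proof.
by rewrite /cl_res mulmxDr addrA (complexmxD (_ + _)) mulmxDl opprD addrA.
Qed.

Lemma cl_res_shiftZ K D (a : R) w x :
  cl_res (K + a *: D) w x = cl_res K w x - a%:C *: (complexmx (B *m D) *m x).
Proof. by rewrite cl_res_shift -scalemxAr complexmxZ_mul. Qed.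

Lemma cl_resE K w x :
  cl_res K w x = ((cexpi w)%:M - complexmx (A + B *m K)) *m x.
Proof. by rewrite mulmxBl mul_scalar_mx. Qed.

Lemma cl_stateE K w v : stab K -> cl_res K w (cl_state K w v) = complexmx Bw *m v.
Proof.
by move=> sK; rewrite cl_resE mulKVmx // stable_unitmx // normc_cexpi.
Qed.

Lemma cl_state_unique K w v x : stab K ->
  cl_res K w x = complexmx Bw *m v -> x = cl_state K w v.
Proof.
move=> sK; rewrite cl_resE /cl_state => <-.
by rewrite mulKmx // stable_unitmx // normc_cexpi.
Qed.

Lemma cl_res_bound K m w x : resolvent_bound (A + B *m K) m ->
  cnorm x <= m * cnorm (cl_res K w x).
Proof. by apply; rewrite normc_cexpi. Qed.

Lemma Tzw_mul K w v : T K w *m v = complexmx (cl_output K) *m cl_state K w v.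
Proof. by rewrite /Tzw /cl_output /cl_state !mulmxA. Qed.

Lemma cl_output_split K :
  cl_output K = col_mx (psd_sqrt Q) 0 + col_mx 0 (psd_sqrt Ru) *m K.
Proof. by rewrite /cl_output mul_col_mx mul0mx add_col_mx addr0 add0r. Qed.

Lemma cl_output_sqn K (x : 'cV[R]_nx) :
  positive_definite Q -> positive_definite Ru ->
  sqn (cl_output K *m x) = quad Q x + quad Ru (K *m x).
Proof.
by move=> pQ pR; rewrite mul_col_mx sqn_col_mx -mulmxA !psd_sqrtP.
Qed.

Lemma Tzw_bounded K : stab K ->
  exists2 c : R, 0 <= c & forall w v, cnorm (T K w *m v) <= c * cnorm v.
Proof.
move=> sK; have [m m0 hm] := stable_resolvent sK.
pose a := (nx + nu)%:R * nx%:R * `|cl_output K|.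
pose b := nx%:R * nw%:R * `|Bw|.
have a0 : 0 <= a by rewrite !mulr_ge0.
have b0 : 0 <= b by rewrite !mulr_ge0.
exists (a * (m * b)) => [|w v]; first by rewrite !mulr_ge0 // ltW.
rewrite Tzw_mul; apply: le_trans (cnorm_mul_le _ _) _.
rewrite -/a -[leRHS]mulrA ler_wpM2l // -mulrA.
apply: le_trans (cl_res_bound w (cl_state K w v) hm) _.
rewrite (cl_stateE _ _ sK) ler_pM2l //.
exact: cnorm_mul_le.
Qed.

Lemma hinf_cost_le K c : 0 <= c ->
  (forall w : R, w \in `[0, 2 * pi]%R -> forall v, cnorm (T K w *m v) <= c * cnorm v) ->
  J K <= c.
Proof.
move=> c0 h; apply: ge_sup.
  exists (sigma_max (T K 0)); exists 0 => //=.
  by rewrite in_itv /= lexx mulr_ge0 // pi_ge0.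
by move=> _ [w hw <-]; apply: sigma_max_le => // v; apply: h.
Qed.

Lemma hinf_cost_ub K w v : stab K -> w \in `[0, 2 * pi]%R ->
  cnorm (T K w *m v) <= J K * cnorm v.
Proof.
move=> sK hw; have [c c0 hc] := Tzw_bounded sK.
have [s0 hs] := sigma_max_bound (T K w) v.
apply: le_trans hs _; rewrite ler_wpM2r ?cnorm_ge0 //.
apply: ub_le_sup; last by exists w.
by exists c => _ [u hu <-]; apply: sigma_max_le => //.
Qed.

Lemma hinf_cost_ge0 K : stab K -> 0 <= J K.
Proof.
move=> sK; have [c c0 hc] := Tzw_bounded sK.
have h0 : (0 : R) \in `[0, 2 * pi]%R by rewrite in_itv /= lexx mulr_ge0 // pi_ge0.
have [s0 _] := sigma_max_bound (T K 0) 0.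
apply: le_trans s0 _; apply: ub_le_sup; last by exists 0.
by exists c => _ [u hu <-]; apply: sigma_max_le => //.
Qed.

(** The two identities behind the second-order estimate: second differences at
    the points [0], [t], [s] of a line, with [t = tau * s]. *)
Lemma residual_combination n (t s tau : C) (b p q : 'cV[C]_n) : t = tau * s ->
  b - (1 - tau) *: (b - t *: p) - tau *: (b - (t - s) *: q)
    = (t * (1 - tau)) *: (p - q).
Proof. by move=> ->; apply/matrixP => i j; rewrite !mxE; ring. Qed.

Lemma output_combination n (t s tau : C) (p q r gq gr : 'cV[C]_n) : t = tau * s ->
  r + t *: gr = (1 - tau) *: p + tau *: (q + s *: gq)
    + (r - (1 - tau) *: p - tau *: q + t *: (gr - gq)).
Proof. by move=> ->; apply/matrixP => i j; rewrite !mxE; ring. Qed.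

Let G : 'M[R]_(nx + nu, nu) := col_mx (0 : 'M[R]_(nx, nu)) (psd_sqrt Ru).

Lemma output_shift (Y D : 'M[R]_(nu, nx)) (x : 'cV[C]_nx) :
  complexmx (cl_output (Y + D)) *m x = complexmx (cl_output Y) *m x
    + complexmx G *m (complexmx D *m x).
Proof.
rewrite !cl_output_split mulmxDr addrA (complexmxD (_ + _)) mulmxDl.
by rewrite (complexmxM _ D) -mulmxA.
Qed.

Lemma output_shiftZ (Y D : 'M[R]_(nu, nx)) (a : R) (x : 'cV[C]_nx) :
  complexmx (cl_output (Y + a *: D)) *m x = complexmx (cl_output Y) *m x
    + a%:C *: (complexmx G *m (complexmx D *m x)).
Proof. by rewrite output_shift complexmxZ_mul -scalemxAr. Qed.

(** The second difference of the resolvent along a line solves a resolvent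
    equation whose right-hand side is [t] times a first difference: this is the
    source of the product [t * s] in the weak convexity estimate. *)
Lemma state_second_difference (Y D : 'M[R]_(nu, nx)) (s t tau w : R) b x xs xt :
  t = tau * s -> cl_res Y w x = b -> cl_res (Y + s *: D) w xs = b ->
  cl_res (Y + t *: D) w xt = b ->
  cl_res (Y + t *: D) w (xt - (1 - tau)%:C *: x - tau%:C *: xs)
    = (t * (1 - tau))%:C *: (complexmx (B *m D) *m (x - xs)).
Proof.
move=> et ex es ext; rewrite !cl_resB !cl_resZ ext cl_res_shiftZ ex.
have -> : Y + t *: D = Y + s *: D + (t - s) *: D.
  by rewrite -addrA -scalerDl [s + _]addrC subrK.
rewrite cl_res_shiftZ es mulmxBr (realcM t (1 - tau)) (realcB t s) (realcB 1 tau).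
by apply: residual_combination; rewrite et realcM.
Qed.

Lemma output_second_difference (Y D : 'M[R]_(nu, nx)) (s t tau : R)
    (x xs xt : 'cV[C]_nx) : t = tau * s ->
  complexmx (cl_output (Y + t *: D)) *m xt
   = (1 - tau)%:C *: (complexmx (cl_output Y) *m x)
     + tau%:C *: (complexmx (cl_output (Y + s *: D)) *m xs)
     + (complexmx (cl_output Y) *m (xt - (1 - tau)%:C *: x - tau%:C *: xs)
     + t%:C *: (complexmx G *m (complexmx D *m (xt - xs)))).
Proof.
move=> et; rewrite !output_shiftZ !mulmxBr -!scalemxAr (realcB 1 tau).
by apply: output_combination; rewrite et realcM.
Qed.

Section UniformBounds.
Variables (S : set 'M[R]_(nu, nx)) (m rho b d k f g : R).
Hypothesis m0 : 0 < m.
Hypothesis resS : forall Y, S Y -> resolvent_bound (A + B *m Y) m.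
Hypothesis bndS : forall Y, S Y -> `|Y| <= rho.
Hypotheses (rho0 : 0 <= rho) (b0 : 0 <= b) (d0 : 0 <= d) (k0 : 0 <= k).
Hypotheses (f0 : 0 <= f) (g0 : 0 <= g).
Hypothesis B_le : forall u : 'cV[C]_nu, cnorm (complexmx B *m u) <= b * cnorm u.
Hypothesis D_le : forall (D : 'M[R]_(nu, nx)) (x : 'cV[C]_nx),
  cnorm (complexmx D *m x) <= d * `|D| * cnorm x.
Hypothesis Bw_le : forall v : 'cV[C]_nw, cnorm (complexmx Bw *m v) <= k * cnorm v.
Hypothesis F_le : forall x : 'cV[C]_nx,
  cnorm (complexmx (col_mx (psd_sqrt Q) (0 : 'M[R]_(nu, nx))) *m x) <= f * cnorm x.
Hypothesis G_le : forall u : 'cV[C]_nu, cnorm (complexmx G *m u) <= g * cnorm u.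

Let stabS Y : S Y -> stab Y.
Proof. by move=> /resS; apply: resolvent_stable. Qed.

Let cl_state_le Y w v : S Y -> cnorm (cl_state Y w v) <= m * k * cnorm v.
Proof.
move=> SY; apply: le_trans (cl_res_bound w (cl_state Y w v) (resS SY)) _.
rewrite (cl_stateE _ _ (stabS SY)) -mulrA; apply: ler_wpM2l; first exact: ltW.
exact: Bw_le.
Qed.

Let BD_le D (x : 'cV[C]_nx) :
  cnorm (complexmx (B *m D) *m x) <= b * (d * `|D| * cnorm x).
Proof.
rewrite complexmxM -mulmxA; apply: le_trans (B_le _) _.
by apply: ler_wpM2l => //; exact: D_le.
Qed.

Let cl_state_lip : exists2 l : R, 0 <= l & forall Y Y' w v, S Y -> S Y' ->
  cnorm (cl_state Y' w v - cl_state Y w v) <= l * `|Y' - Y| * cnorm v.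
Proof.
exists (m * (b * (d * (m * k)))) => [|Y Y' w v SY SY'].
  by rewrite !mulr_ge0 // ltW.
apply: le_trans (cl_res_bound w _ (resS SY')) _.
have -> : cl_res Y' w (cl_state Y' w v - cl_state Y w v)
    = complexmx (B *m (Y' - Y)) *m cl_state Y w v.
  rewrite cl_resB (cl_stateE _ _ (stabS SY')) -{1}(subrK Y Y') [_ - _ + Y]addrC.
  by rewrite cl_res_shift (cl_stateE _ _ (stabS SY)) opprB addrC subrK.
apply: (@le_trans _ _ (m * (b * (d * `|Y' - Y| * (m * k * cnorm v))))).
  apply: ler_wpM2l; first exact: ltW.
  apply: le_trans (BD_le _ _) _; apply: ler_wpM2l => //; apply: ler_wpM2l.
    by rewrite mulr_ge0.
  exact: cl_state_le.
by apply: eq_le_r; ring.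
Qed.

Let output_le Y (x : 'cV[C]_nx) : S Y ->
  cnorm (complexmx (cl_output Y) *m x) <= (f + g * (d * rho)) * cnorm x.
Proof.
move=> SY; rewrite cl_output_split complexmxD mulmxDl complexmxM -mulmxA mulrDl.
apply: le_trans (cnormD _ _) _; apply: lerD; first exact: F_le.
apply: le_trans (G_le _) _; rewrite -mulrA; apply: ler_wpM2l => //.
apply: le_trans (D_le _ _) _; apply: ler_wpM2r; first exact: cnorm_ge0.
by apply: ler_wpM2l => //; exact: bndS.
Qed.

Let output_shift_le D (x : 'cV[C]_nx) :
  cnorm (complexmx G *m (complexmx D *m x)) <= g * (d * `|D| * cnorm x).
Proof.
by apply: le_trans (G_le _) _; apply: ler_wpM2l => //; exact: D_le.
Qed.

Lemma hinf_cost_lipschitz : exists2 L : R, 0 <= L &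
  forall Y Y' : 'M[R]_(nu, nx), S Y -> S Y' -> J Y' <= J Y + L * `|Y' - Y|.
Proof.
have [l l0 lip] := cl_state_lip.
pose L := (f + g * (d * rho)) * l + g * (d * (m * k)).
have L0 : 0 <= L by rewrite addr_ge0 ?mulr_ge0 ?addr_ge0 ?mulr_ge0 ?(ltW m0).
exists L => // Y Y' SY SY'; have sY := stabS SY.
apply: hinf_cost_le => [|w hw v].
  by rewrite addr_ge0 ?mulr_ge0 ?hinf_cost_ge0.
rewrite Tzw_mul; set x := cl_state Y w v; set x' := cl_state Y' w v.
have -> : complexmx (cl_output Y') *m x' =
    T Y w *m v + (complexmx (cl_output Y') *m (x' - x)
    + complexmx G *m (complexmx (Y' - Y) *m x)).
  rewrite Tzw_mul addrCA -output_shift [Y + _]addrC subrK -mulmxDr.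
  by rewrite subrK.
apply: le_trans (cnormD _ _) _; rewrite mulrDl; apply: lerD; first exact: hinf_cost_ub.
apply: le_trans (cnormD _ _) _.
apply: (@le_trans _ _ ((f + g * (d * rho)) * (l * `|Y' - Y| * cnorm v)
    + g * (d * `|Y' - Y| * (m * k * cnorm v)))); last first.
  by apply: eq_le_r; rewrite /L; ring.
clear sY; apply: lerD.
  apply: le_trans (output_le _ SY') _; apply: ler_wpM2l.
    by rewrite addr_ge0 ?mulr_ge0.
  exact: lip.
apply: le_trans (output_shift_le _ _) _; apply: ler_wpM2l => //.
by apply: ler_wpM2l; [rewrite mulr_ge0 | exact: cl_state_le].
Qed.

(** The operator norm is convex and the transfer matrix is affine in the gain up
    to a second difference of order [t * s * `|D| ^+ 2], uniformly in the
    frequency; a supremum over frequencies inherits the estimate. *)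
Lemma hinf_cost_weakly_convex : exists2 c : R, 0 <= c &
  forall (Y D : 'M[R]_(nu, nx)) (s t : R), 0 < s -> 0 <= t <= s ->
    S Y -> S (Y + t *: D) -> S (Y + s *: D) ->
    J (Y + t *: D) <= (1 - t / s) * J Y + t / s * J (Y + s *: D)
                      + c * (t * s * `|D| ^+ 2).
Proof.
have [l l0 lip] := cl_state_lip.
pose c := (f + g * (d * rho)) * (m * (b * (d * l))) + g * (d * l).
have c0 : 0 <= c by rewrite addr_ge0 ?mulr_ge0 ?addr_ge0 ?mulr_ge0 ?(ltW m0).
exists c => // Y D s t s0 /andP[t0 ts] SY SYt SYs.
have tau0 : 0 <= t / s by rewrite divr_ge0 // ltW.
have tau1 : 0 <= 1 - t / s by rewrite subr_ge0 ler_pdivrMr // mul1r.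
have [tau tauE] : exists tau, tau = t / s by exists (t / s).
rewrite -!tauE in tau0 tau1 *.
have et : t = tau * s by rewrite tauE divfK // gt_eqF.
have sY := stabS SY; have sYs := stabS SYs; have sYt := stabS SYt.
have JY (w : R) v (hw : w \in `[0, 2 * pi]%R) := hinf_cost_ub v sY hw.
have JYs (w : R) v (hw : w \in `[0, 2 * pi]%R) := hinf_cost_ub v sYs hw.
move: (hinf_cost_ge0 sY) (hinf_cost_ge0 sYs) JY JYs.
move: (J Y) (J (Y + s *: D)) => j js j0 js0 JY JYs.
apply: hinf_cost_le => [|w hw v].
  apply: addr_ge0; first by rewrite addr_ge0 ?mulr_ge0.
  by rewrite !mulr_ge0 ?(ltW s0).
rewrite Tzw_mul; set x := cl_state Y w v; set xs := cl_state (Y + s *: D) w v.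
set xt := cl_state _ w v.
have {}JY := JY w v hw; have {}JYs := JYs w v hw.
rewrite Tzw_mul -/x in JY; rewrite Tzw_mul -/xs in JYs.
have esd := state_second_difference et (cl_stateE w v sY) (cl_stateE w v sYs)
  (cl_stateE w v sYt).
have e_le : cnorm (xt - (1 - tau)%:C *: x - tau%:C *: xs)
    <= m * (b * (d * l)) * (t * s * `|D| ^+ 2) * cnorm v.
  clear sY sYs sYt JY JYs.
  apply: le_trans (cl_res_bound w _ (resS SYt)) _; rewrite esd.
  rewrite cnormZ normcR ger0_norm ?mulr_ge0 //.
  apply: (@le_trans _ _ (m * (t * (b * (d * `|D| * (l * `|s *: D| * cnorm v)))))).
    rewrite (ler_pM2l m0) -[leLHS]mulrA; apply: (ler_wpM2l t0).
    apply: (@le_trans _ _ (cnorm (complexmx (B *m D) *m (x - xs)))).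
      by apply: ler_piMl; rewrite ?cnorm_ge0 // gerBl.
    apply: le_trans (BD_le _ _) _; apply: ler_wpM2l => //.
    apply: ler_wpM2l; first by rewrite mulr_ge0.
    rewrite -cnormN opprB.
    by have := lip _ _ w v SY SYs; rewrite [_ + s *: D - _]addrAC subrr add0r.
  rewrite normrZ (gtr0_norm s0); move: (cnorm v) `|D| => nv nD.
  by apply: eq_le_r; ring.
clear sY sYs sYt esd; rewrite (output_second_difference Y D x xs xt et).
have first_le : cnorm ((1 - tau)%:C *: (complexmx (cl_output Y) *m x)
    + tau%:C *: (complexmx (cl_output (Y + s *: D)) *m xs))
    <= ((1 - tau) * j + tau * js) * cnorm v.
  apply: le_trans (cnorm_comb _ _ tau1 tau0) _.
  apply: le_trans (lerD (ler_wpM2l tau1 JY) (ler_wpM2l tau0 JYs)) _.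
  by move: (cnorm v) => nv; apply: eq_le_r; ring.
have second_le :
    cnorm (complexmx (cl_output Y) *m (xt - (1 - tau)%:C *: x - tau%:C *: xs))
    <= (f + g * (d * rho)) * (m * (b * (d * l)) * (t * s * `|D| ^+ 2) * cnorm v).
  apply: le_trans (output_le _ SY) _; apply: ler_wpM2l e_le.
  by rewrite addr_ge0 ?mulr_ge0.
have third_le : cnorm (t%:C *: (complexmx G *m (complexmx D *m (xt - xs))))
    <= t * (g * (d * `|D| * (l * (s * `|D|) * cnorm v))).
  rewrite (cnormZ_ge0 _ t0); apply: (ler_wpM2l t0).
  apply: le_trans (output_shift_le _ _) _; apply: (ler_wpM2l g0).
  apply: ler_wpM2l; first by rewrite mulr_ge0.
  apply: le_trans (lip _ _ w v SYs SYt) _.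
  apply: ler_wpM2r; first exact: cnorm_ge0.
  apply: (ler_wpM2l l0).
  rewrite opprD addrACA subrr add0r -scalerBl normrZ; apply: ler_wpM2r => //.
  by rewrite ler0_norm ?subr_le0 // opprB lerBlDr lerDl.
apply: le_trans (cnormD _ _) _.
apply: le_trans (lerD first_le (le_trans (cnormD _ _) (lerD second_le third_le))) _.
by move: (cnorm v) `|D| => nv nD; apply: eq_le_r; rewrite /c; ring.
Qed.
End UniformBounds.

Lemma small_radius (m b : R) : 0 < m -> 0 <= b ->
  exists2 r : R, 0 < r & forall y, 0 <= y <= r -> m * (b * y) <= 2^-1.
Proof.
move=> m0 b0; have q0 : 0 < 2 * (m * b + 1).
  by rewrite mulr_gt0 // ltr_wpDl // mulr_ge0 // ltW.
exists (2 * (m * b + 1))^-1 => [|y /andP[y0 yr]]; first by rewrite invr_gt0.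
apply: (@le_trans _ _ (m * b * (2 * (m * b + 1))^-1)).
  by rewrite mulrA ler_wpM2l // mulr_ge0 // ltW.
rewrite ler_pdivrMr //.
have -> : 2^-1 * (2 * (m * b + 1)) = m * b + 1 by field.
by rewrite lerDl.
Qed.

Lemma stabilizing_gains_nbhs K : stab K ->
  exists r m : R, [/\ 0 < r, 0 < m
    & forall Y, `|Y - K| <= r -> resolvent_bound (A + B *m Y) m].
Proof.
move=> sK; have [m m0 hm] := stable_resolvent sK; clear sK.
have [b b0 hb] := complexmx_bounded B.
have d0 : 0 <= nu%:R * nx%:R :> R by apply: mulr_ge0.
have [r r0 hr] := small_radius m0 (mulr_ge0 b0 d0).
exists r, (2 * m); split; [exact: r0 | exact: mulr_gt0 | ].
move=> Y hY; have -> : A + B *m Y = A + B *m K + B *m (Y - K).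
  by rewrite -addrA -mulmxDr [K + _]addrC subrK.
apply: (resolvent_perturb m0 hm) => x; rewrite complexmxM -mulmxA.
apply: (@le_trans _ _ (m * (b * (nu%:R * nx%:R * `|Y - K| * cnorm x)))).
  apply: (ler_wpM2l (ltW m0)); apply: le_trans (hb _) _.
  exact: (ler_wpM2l b0 (cnorm_mul_le _ _)).
have := hr `|Y - K|; rewrite normr_ge0 hY => /(_ isT) h.
move: (cnorm x) (cnorm_ge0 x) `|Y - K| h => nx0 nx1 y h.
by rewrite -mulrA !mulrA in h *; apply: ler_wpM2r.
Qed.

(** All regularity of the cost that is used: near a stabilizing gain it is
    Lipschitz, and convex up to a quadratic error. *)
Lemma hinf_cost_local K : stab K -> exists r L c : R,
  [/\ 0 < r, 0 <= L /\ 0 <= c,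
      forall Y, `|Y - K| <= r -> stab Y,
      forall Y Y', `|Y - K| <= r -> `|Y' - K| <= r -> J Y' <= J Y + L * `|Y' - Y|
    & forall (Y D : 'M[R]_(nu, nx)) (s t : R), 0 < s -> 0 <= t <= s ->
        `|Y - K| <= r -> `|Y + t *: D - K| <= r -> `|Y + s *: D - K| <= r ->
        J (Y + t *: D) <= (1 - t / s) * J Y + t / s * J (Y + s *: D)
                          + c * (t * s * `|D| ^+ 2)].
Proof.
move=> /stabilizing_gains_nbhs[r [m [r0 m0 hm]]].
have [b b0 hb] := complexmx_bounded B.
have [k k0 hk] := complexmx_bounded Bw.
have [f f0 hf] := complexmx_bounded (col_mx (psd_sqrt Q) (0 : 'M[R]_(nu, nx))).
have [g g0 hg] := complexmx_bounded G.
have d0 : 0 <= nu%:R * nx%:R :> R by apply: mulr_ge0.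
have hd (D : 'M[R]_(nu, nx)) (x : 'cV[C]_nx) :
  cnorm (complexmx D *m x) <= nu%:R * nx%:R * `|D| * cnorm x by exact: cnorm_mul_le.
have rho0 : 0 <= `|K| + r by rewrite addr_ge0 // ltW.
have hrho Y : [set Y : 'M[R]_(nu, nx) | `|Y - K| <= r] Y -> `|Y| <= `|K| + r.
  move=> /= hY; rewrite -[Y](subrK K) addrC.
  by apply: le_trans (ler_normD _ _) _; rewrite lerD2l.
have [L L0 hL] := hinf_cost_lipschitz m0 hm hrho rho0 b0 d0 k0 f0 g0 hb hd hk hf hg.
have [c c0 hc] := hinf_cost_weakly_convex m0 hm hrho rho0 b0 d0 k0 f0 g0 hb hd hk hf hg.
exists r, L, c; split; [exact: r0 | by split | | exact: hL | exact: hc].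
by move=> Y hY; exact: resolvent_stable (hm Y hY).
Qed.

End Cost.

(** * Discrete Fourier transform *)

Section Fourier.
Variable R : realType.
Local Notation C := R[i].

Lemma cexpiD (a b : R) : cexpi (a + b) = cexpi a * cexpi b.
Proof.
rewrite /cexpi cosD sinD.
by apply/eqP; rewrite eq_complex /=; apply/andP; split; apply/eqP; ring.
Qed.

Lemma cexpi0 : cexpi (0 : R) = 1.
Proof. by rewrite /cexpi cos0 sin0. Qed.

Lemma cexpiX (a : R) k : cexpi a ^+ k = cexpi (a * k%:R).
Proof.
elim: k => [|k IH]; first by rewrite mulr0 cexpi0.
by rewrite exprS IH -cexpiD -natr1; congr cexpi; ring.
Qed.

Lemma cexpi_conj (a : R) : Num.conj (cexpi a) = cexpi (- a).
Proof. by rewrite /cexpi cosN sinN. Qed.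

Lemma cexpi_2pi_nat k : cexpi (2 * pi * k%:R : R) = 1.
Proof. by rewrite -cexpiX /cexpi mulr_natl cos2pi sin2pi expr1n. Qed.

Lemma cexpi_neq1 (a : R) : 0 < a < 2 * pi -> cexpi a != 1.
Proof.
move=> /andP[a0 a2]; apply/eqP => -[h _].
have : cos a = 1 - 2 * sin (a / 2) ^+ 2.
  have -> : a = a / 2 + a / 2 by field.
  rewrite cosD; have -> : (a / 2 + a / 2) / 2 = a / 2 by field.
  by have := cos2Dsin2 (a / 2); lra.
have : 0 < sin (a / 2).
  by apply: sin_gt0_pi; rewrite divr_gt0 //= ltr_pdivrMr //; lra.
by move=> s0; have := exprn_gt0 2 s0; lra.
Qed.

(** A geometric sum whose ratio is an [N]-th root of unity, different from [1]
    unless [t = s] because [0 < `|t - s| < N]. *)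
Lemma dft_orthogonal (N t s : nat) : (t < N)%N -> (s < N)%N ->
  \sum_(k < N) cexpi (2 * pi * k%:R / N%:R * (t%:R - s%:R) : R)
    = if t == s then N%:R else 0.
Proof.
move=> tN sN; have N0 : N%:R != 0 :> R by rewrite pnatr_eq0; case: (N) tN.
have [->|ts] := eqVneq t s.
  rewrite (eq_bigr (fun=> 1)) => [|k _]; last by rewrite subrr mulr0 cexpi0.
  by rewrite sumr_const card_ord.
pose u := cexpi (2 * pi / N%:R * (t%:R - s%:R) : R).
rewrite (eq_bigr (fun k : 'I_N => u ^+ k)) => [|k _]; last first.
  by rewrite cexpiX; congr cexpi; ring.
have u1 : u != 1.
  apply/eqP => hu.
  have key (p q : nat) : (p < q)%N -> (q < N)%N ->
      cexpi (2 * pi / N%:R * (q%:R - p%:R) : R) != 1.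
    move=> pq qN; apply: cexpi_neq1.
    have N1 : 0 < N%:R :> R by rewrite ltr0n (leq_ltn_trans _ qN).
    have p0 := pi_gt0 R.
    rewrite -natrB 1?ltnW // mulr_gt0 ?divr_gt0 ?mulr_gt0 ?ltr0n ?subn_gt0 //=;
      last first.
      by rewrite (leq_ltn_trans _ qN).
    rewrite mulrAC ltr_pdivrMr // ltr_pM2l ?mulr_gt0 // ltr_nat.
    by rewrite (leq_ltn_trans _ qN) // leq_subr.
  move: ts; rewrite neq_ltn => /orP[ts|st].
    have := key _ _ ts sN; rewrite -[s%:R - _]opprB mulrN -cexpi_conj.
    by rewrite -/u hu rmorph1 eqxx.
  by have := key _ _ st tN; rewrite -/u hu eqxx.
have : (u - 1) * \sum_(k < N) u ^+ k = u ^+ N - 1 by rewrite subrX1.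
have -> : u ^+ N = 1.
  rewrite /u cexpiX.
  have -> : 2 * pi / N%:R * (t%:R - s%:R) * N%:R = 2 * pi * t%:R + - (2 * pi * s%:R) :> R.
    by field.
  by rewrite cexpiD -cexpi_conj !cexpi_2pi_nat rmorph1 mulr1.
rewrite subrr => /eqP; rewrite mulf_eq0 subr_eq0 (negPf u1) /= => /eqP.
by [].
Qed.

Definition dft n (p : nat -> 'cV[R]_n) (N : nat) (w : R) : 'cV[C]_n :=
  \sum_(t < N) cexpi (- (w * t%:R)) *: complexmx (p t).

Lemma dft_mul m n (M : 'M[R]_(m, n)) (p : nat -> 'cV[R]_n) N w :
  complexmx M *m dft p N w = dft (fun t => M *m p t) N w.
Proof.
rewrite /dft mulmx_sumr; apply: eq_bigr => t _.
by rewrite complexmxM scalemxAr.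
Qed.

Lemma dft_add n (p q : nat -> 'cV[R]_n) N w :
  dft (fun t => p t + q t) N w = dft p N w + dft q N w.
Proof.
rewrite /dft -big_split; apply: eq_bigr => t _ /=.
by rewrite complexmxD scalerDr.
Qed.

(** The shift identity has no boundary term since [p] vanishes at both ends of
    the window. *)
Lemma dft_shift n (p : nat -> 'cV[R]_n) N w : p 0%N = 0 -> p N = 0 ->
  cexpi w *: dft p N w = dft (fun t => p t.+1) N w.
Proof.
have c0 : complexmx (0 : 'cV[R]_n) = 0 by exact: (map_mx0 (real_complex R)).
case: N => [|N] p0 pN; first by rewrite /dft !big_ord0 scaler0.
rewrite /dft big_ord_recl big_ord_recr /= p0 pN c0 !scaler0 addr0 add0r.
rewrite scaler_sumr; apply: eq_bigr => t _.
rewrite scalerA -cexpiD /bump /= add1n -natr1; congr (cexpi _ *: _); ring.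
Qed.

Lemma parseval n (p : nat -> 'cV[R]_n) N :
  \sum_(k < N) csqn (dft p N (2 * pi * k%:R / N%:R))
    = N%:R * \sum_(t < N) sqn (p t).
Proof.
under eq_bigr do rewrite csqn_sum.
rewrite exchange_big mulr_sumr.
under [RHS]eq_bigr do rewrite sqnE mulr_sumr.
rewrite [RHS]exchange_big; apply: eq_bigr => i _ /=.
apply: complexI; rewrite !rmorph_sum /=.
pose a (t : nat) : C := (p t i 0)%:C.
have ea t : Num.conj (a t) = a t.
  by apply/eqP; rewrite eq_complex /= oppr0 !eqxx.
transitivity (\sum_(k < N) \sum_(t < N) \sum_(s < N)
    a t * a s * cexpi (2 * pi * k%:R / N%:R * (t%:R - s%:R) : R)).
  apply: eq_bigr => k _; rewrite -mulC_conj /dft summxE rmorph_sum mulr_suml.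
  apply: eq_bigr => t _; rewrite mulr_sumr; apply: eq_bigr => s _.
  rewrite !mxE rmorphM /= -[(p t i 0)%:C]/(a t) -[(p s i 0)%:C]/(a s) ea cexpi_conj.
  rewrite mulrACA -cexpiD mulrC.
  by congr (_ * cexpi _); ring.
rewrite exchange_big; apply: eq_bigr => t _ /=.
rewrite exchange_big (bigD1 t) //= [X in _ + X]big1 => [|s st].
  rewrite -mulr_sumr dft_orthogonal // eqxx addr0.
  by rewrite rmorphM rmorph_nat mulrC -rmorphM -expr2.
by rewrite -mulr_sumr dft_orthogonal // val_eqE eq_sym (negPf st) mulr0.
Qed.

End Fourier.

(** * Trajectories and their energy gain *)

Section Trajectory.
Variables (R : realType) (n p q : nat).
Variables (F : 'M[R]_n) (G : 'M[R]_(n, p)) (H : 'M[R]_(q, n)).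

Fixpoint traj (x : 'cV[R]_n) (w : nat -> 'cV[R]_p) (t : nat) : 'cV[R]_n :=
  if t is t'.+1 then F *m traj x w t' + G *m w t' else x.

Definition supply (g2 : R) x w N : R :=
  \sum_(t < N) (sqn (H *m traj x w t) - g2 * sqn (w t)).

Lemma traj_comb a b x y u v t :
  traj (a *: x + b *: y) (fun t => a *: u t + b *: v t) t
    = a *: traj x u t + b *: traj y v t.
Proof.
elim: t => //= t ->; rewrite !mulmxDr -!scalemxAr !scalerDr.
by rewrite addrACA.
Qed.

Lemma eq_traj x u v t : (forall s, (s < t)%N -> u s = v s) -> traj x u t = traj x v t.
Proof.
elim: t => //= t IH h; rewrite h // IH // => s st.
by apply: h; rewrite ltnS ltnW.
Qed.

Lemma traj_shift x w t : traj x w t.+1 = traj (F *m x + G *m w 0%N) (fun s => w s.+1) t.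
Proof. by elim: t => //= t <-. Qed.

Lemma traj_free x w N k : (forall t, (N <= t < N + k)%N -> w t = 0) ->
  traj x w (N + k) = iter k (mulmx F) (traj x w N).
Proof.
elim: k => [|k IH] h; first by rewrite addn0.
rewrite addnS /= h ?leq_addr ?addnS ?ltnS ?leqnn // mulmx0 addr0 IH // => t /andP[a b].
by apply: h; rewrite a addnS ltnS ltnW.
Qed.

Lemma supply_shift g2 x w N : supply g2 x w N.+1 =
  sqn (H *m x) - g2 * sqn (w 0%N)
    + supply g2 (F *m x + G *m w 0%N) (fun s => w s.+1) N.
Proof.
rewrite /supply big_ord_recl; congr (_ + _).
by apply: eq_bigr => t _; rewrite lift0 traj_shift.
Qed.

(** Switching the input off after time [N] can only increase the supply, as the
    output energy is nonnegative. *)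
Lemma supply_extend g2 x w N M : (N <= M)%N ->
  supply g2 x w N <= supply g2 x (fun t => if (t < N)%N then w t else 0) M.
Proof.
pose u t := if (t < N)%N then w t else 0; move=> NM; rewrite -/u /supply.
have -> : \sum_(t < N) (sqn (H *m traj x w t) - g2 * sqn (w t)) =
   \sum_(t < N) (sqn (H *m traj x u t) - g2 * sqn (u t)).
  apply: eq_bigr => t _; rewrite {2}/u ltn_ord; congr (sqn (_ *m _) - _).
  by apply: eq_traj => s st; rewrite /u (ltn_trans st).
rewrite -!(big_mkord predT (fun t => sqn (H *m traj x u t) - g2 * sqn (u t))) /=.
rewrite [leRHS](@big_cat_nat _ _ _ N) //= lerDl.
rewrite big_nat_cond; apply: sumr_ge0 => t /andP[/andP[Nt _] _].
by rewrite /u ltnNge Nt /= sqn0 mulr0 subr0 sqn_ge0.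
Qed.

Hypothesis Fstable : spectral_radius F < 1.
Variables (Gr : 'M[R]_(p, n)) (g2 : R).
Hypothesis GGr : G *m Gr = 1%:M.
Hypothesis g2_ge0 : 0 <= g2.
Hypothesis loop_gain : forall (x : nat -> 'cV[R]_n) (w : nat -> 'cV[R]_p) N,
  x 0%N = 0 -> x N = 0 -> (forall t, x t.+1 = F *m x t + G *m w t) ->
  \sum_(t < N) sqn (H *m x t) <= g2 * \sum_(t < N) sqn (w t).

Lemma complexmx_iter k (x : 'cV[R]_n) :
  complexmx (iter k (mulmx F) x) = iter k (mulmx (complexmx F)) (complexmx x).
Proof. by elim: k => //= k <-; rewrite complexmxM. Qed.

(** After time [N] the state is left to decay and then steered to [0] in one
    step, at a cost that vanishes with the length of the decay. *)
Lemma supply_from_0 w N : supply g2 0 w N <= 0.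
Proof.
apply/ler_addgt0Pr => e e0; rewrite add0r.
pose K : R := (p%:R * n%:R * `|Gr *m F|) ^+ 2.
have K0 : 0 <= K by rewrite sqr_ge0.
have d0 : 0 < e / (g2 * K + 1) by rewrite divr_gt0 // ltr_wpDl // mulr_ge0.
pose xN := traj 0 w N.
have [k hk] : exists k, sqn (iter k (mulmx F) xN) < e / (g2 * K + 1).
  have [|k hk] := stable_orbit_small (complexmx xN) Fstable
    (e := Num.sqrt (e / (g2 * K + 1))).
    by rewrite sqrtr_gt0.
  exists k; move: hk; rewrite -complexmx_iter /cnorm csqn_complexmx ltr_sqrt //.
pose u t := if (t < N)%N then w t else
  if t == (N + k)%N then - (Gr *m (F *m iter k (mulmx F) xN)) else 0.
have uw t : (t < N)%N -> u t = w t by rewrite /u => ->.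
have u0 t : (N <= t < N + k)%N -> u t = 0.
  by move=> /andP[a b]; rewrite /u ltnNge a /= ltn_eqF.
have xk : traj 0 u (N + k) = iter k (mulmx F) xN.
  by rewrite traj_free //; congr iter; apply: eq_traj.
have ue : u (N + k)%N = - (Gr *m (F *m iter k (mulmx F) xN)).
  by rewrite /u ltnNge leq_addr /= eqxx.
have xend : traj 0 u (N + k).+1 = 0.
  by rewrite /= xk ue mulmxN (mulmxA G) GGr mul1mx subrr.
have := @loop_gain (traj 0 u) u _ (erefl _) xend (fun t => erefl _).
rewrite [in leRHS]big_ord_recr /= ue sqnN.
have eN : \sum_(t < N + k) sqn (u t) = \sum_(t < N) sqn (w t).
  rewrite big_split_ord /= [X in _ + X]big1 ?addr0 => [|t _].
    by apply: eq_bigr => t _; rewrite uw.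
  by rewrite u0 ?sqn0 // leq_addr ltn_add2l ltn_ord.
have le1 : \sum_(t < N) sqn (H *m traj 0 w t)
    <= \sum_(t < (N + k).+1) sqn (H *m traj 0 u t).
  rewrite -addnS big_split_ord /= -[leLHS]addr0 lerD //; last first.
    by apply: sumr_ge0 => t _; apply: sqn_ge0.
  rewrite le_eqVlt; apply/orP; left; apply/eqP.
  apply: eq_bigr => t _; congr (sqn (_ *m _)); apply: eq_traj => s st.
  by rewrite uw // (ltn_trans st).
have le2 : sqn (Gr *m (F *m iter k (mulmx F) xN)) <= K * (e / (g2 * K + 1)).
  rewrite mulmxA; apply: le_trans (sqn_mul_le _ _) _.
  by rewrite ler_wpM2l // ltW.
have le3 : g2 * (K * (e / (g2 * K + 1))) <= e.
  rewrite mulrA mulrCA ler_piMr ?(ltW e0) //.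
  by rewrite ler_pdivrMr ?mul1r ?lerDl // ltr_wpDl // mulr_ge0.
rewrite eN mulrDr /supply sumrB -mulr_sumr => h.
have := ler_wpM2l g2_ge0 le2; lra.
Qed.

(** The state [x] is reached from [0] in one step by the input [Gr *m x], and a
    trajectory from [0] has nonpositive supply. *)
Lemma supply_bound x w N : supply g2 x w N <= g2 * sqn (Gr *m x).
Proof.
have := supply_from_0 (fun t => if t is s.+1 then w s else Gr *m x) N.+1.
rewrite supply_shift !mulmx0 sqn0 !add0r (mulmxA G) GGr mul1mx /=.
by rewrite addrC subr_le0.
Qed.

(** The available storage of dissipativity theory. *)
Definition storage x : R := sup [set s | exists w, exists N, s = supply g2 x w N].

Lemma storage_has_sup x : has_sup [set s | exists w, exists N, s = supply g2 x w N].
Proof.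
split; first by exists 0; exists (fun=> 0), 0%N; rewrite /supply big_ord0.
by exists (g2 * sqn (Gr *m x)) => _ [w [N ->]]; apply: supply_bound.
Qed.

Lemma supply_le_storage x w N : supply g2 x w N <= storage x.
Proof. by apply: ub_le_sup; [case: (storage_has_sup x)|exists w, N]. Qed.

Lemma storage_le x c : (forall w N, supply g2 x w N <= c) -> storage x <= c.
Proof.
move=> h; apply: ge_sup; first by case: (storage_has_sup x).
by move=> _ [w [N ->]]; apply: h.
Qed.

Lemma storage_ub x : storage x <= g2 * sqn (Gr *m x).
Proof. by apply: storage_le => w N; apply: supply_bound. Qed.

Lemma storage_output x : sqn (H *m x) <= storage x.
Proof.
have := supply_le_storage x (fun=> 0) 1.
by rewrite /supply big_ord_recl big_ord0 /= sqn0 mulr0 subr0 addr0.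
Qed.

Lemma storage_dissipative x w :
  storage (F *m x + G *m w) + sqn (H *m x) - g2 * sqn w <= storage x.
Proof.
rewrite -addrA -lerBrDr; apply: storage_le => u N; rewrite lerBrDr [leLHS]addrC.
have := supply_le_storage x (fun t => if t is s.+1 then u s else w) N.+1.
by rewrite supply_shift.
Qed.

(** The supply is jointly quadratic in the initial state and the input, hence
    obeys the parallelogram law, which survives the supremum over inputs. *)
Lemma storage_parallelogram_le x y :
  2 * storage x + 2 * storage y <= storage (x + y) + storage (x - y).
Proof.
(* Inputs of different lengths are padded with zeros to a common horizon. *)
suff h u N v M : 2 * supply g2 x u N + 2 * supply g2 y v M
    <= storage (x + y) + storage (x - y).
  rewrite -mulrDr mulrC -ler_pdivlMr //.
  rewrite -lerBrDr; apply: storage_le => u N; rewrite lerBrDr addrC.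
  rewrite -lerBrDr; apply: storage_le => v M; rewrite lerBrDr.
  by rewrite ler_pdivlMr // mulrC mulrDr [leLHS]addrC h.
pose u' t := if (t < N)%N then u t else 0.
pose v' t := if (t < M)%N then v t else 0.
apply: (@le_trans _ _ (2 * supply g2 x u' (maxn N M) + 2 * supply g2 y v' (maxn N M))).
  by rewrite lerD // ler_pM2l // supply_extend // ?leq_maxl ?leq_maxr.
apply: (@le_trans _ _ (supply g2 (x + y) (fun t => u' t + v' t) (maxn N M)
   + supply g2 (x - y) (fun t => u' t - v' t) (maxn N M))); last first.
  by rewrite lerD // supply_le_storage.
rewrite /supply !mulr_sumr -!big_split /=; apply: ler_sum => t _.
have e1 : traj (x + y) (fun t => u' t + v' t) t = traj x u' t + traj y v' t.
  have := traj_comb 1 1 x y u' v' t; rewrite !scale1r => <-.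
  by apply: eq_traj => s _; rewrite !scale1r.
have e2 : traj (x - y) (fun t => u' t - v' t) t = traj x u' t - traj y v' t.
  have := traj_comb 1 (-1) x y u' v' t; rewrite !scale1r !scaleN1r => <-.
  by apply: eq_traj => s _; rewrite scale1r scaleN1r.
rewrite e1 e2 mulmxBr mulmxDr !sqnD !sqnN !dotNr le_eqVlt; apply/orP; left.
by apply/eqP; ring.
Qed.

Lemma storage_double x : storage (2 *: x) <= 4 * storage x.
Proof.
apply: storage_le => w N.
have e t : traj (2 *: x) w t = 2 *: traj x (fun s => 2^-1 *: w s) t.
  have := traj_comb 2 0 x 0 (fun s => 2^-1 *: w s) (fun=> 0) t.
  rewrite !scale0r !addr0 => <-; apply: eq_traj => s _.
  by rewrite /= addr0 scalerA divff // scale1r.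
have -> : supply g2 (2 *: x) w N = 4 * supply g2 x (fun s => 2^-1 *: w s) N.
  rewrite /supply mulr_sumr; apply: eq_bigr => t _.
  by rewrite e -scalemxAr !sqnZ; field.
by rewrite ler_pM2l // supply_le_storage.
Qed.

(** The reverse inequality is the same one at [x + y] and [x - y]. *)
Lemma storage_parallelogram x y :
  storage (x + y) + storage (x - y) = 2 * storage x + 2 * storage y.
Proof.
apply/le_anti; rewrite storage_parallelogram_le andbT.
have := storage_parallelogram_le (x + y) (x - y).
have -> : x + y + (x - y) = 2 *: x by rewrite addrACA subrr addr0 scaler_nat.
have -> : x + y - (x - y) = 2 *: y.
  by rewrite opprB addrC addrA subrK scaler_nat.
have := storage_double x; have := storage_double y; lra.
Qed.

End Trajectory.

(** * Quadratic forms from the parallelogram law *)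

Section JordanVonNeumann.
Variable R : realType.

(** The defect [k c = h c - c * h 1] is additive and [1]-periodic, so it is
    bounded everywhere; then [n * k c = k (n * c)] forces it to vanish. *)
Lemma bounded_additive_linear (h : R -> R) (M : R) :
  (forall a b, h (a + b) = h a + h b) ->
  (forall c, 0 <= c <= 1 -> `|h c| <= M) -> forall c, h c = c * h 1.
Proof.
move=> hD hM.
pose k c := h c - c * h 1.
have kD a b : k (a + b) = k a + k b by rewrite /k hD; ring.
have h0 : h 0 = 0 by apply: (addrI (h 0)); rewrite -hD !addr0.
have hN a : h (- a) = - h a by apply: (addrI (h a)); rewrite -hD !subrr.
have kN a : k (- a) = - k a by rewrite /k hN; ring.
have k0 : k 0 = 0 by rewrite /k h0 mul0r subrr.
have k1 : k 1 = 0 by rewrite /k mul1r subrr.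
have kX c (n : nat) : k (c * n%:R) = n%:R * k c.
  elim: n => [|n IH]; first by rewrite mulr0 mul0r.
  by rewrite -natr1 mulrDr mulr1 kD IH mulrDl mul1r.
have kn (n : nat) : k n%:R = 0 by rewrite -[n%:R]mul1r kX k1 mulr0.
have kz (z : int) : k z%:~R = 0.
  by case: z => n; rewrite ?NegzE ?mulrNz ?kN -?pmulrn kn ?oppr0.
have kM c : `|k c| <= M + `|h 1|.
  pose f : int := Num.floor c.
  have -> : k c = k (c - f%:~R) by rewrite kD kN kz oppr0 addr0.
  have c01 : 0 <= c - f%:~R <= 1.
    rewrite subr_ge0 floor_le /= lerBlDr addrC ltW //.
    by rewrite -[1]/(1%:~R) -intrD floorD1_gt.
  apply: le_trans (ler_normB _ _) _; rewrite lerD ?hM // normrM ler_piMl //.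
  by case/andP: c01 => ? ?; rewrite ger0_norm.
move=> c; apply/eqP; rewrite -subr_eq0 -normr_eq0 -/(k c); apply/eqP/le_anti.
rewrite normr_ge0 andbT; apply: (@le_of_natmul _ _ (M + `|h 1|)) => n.
by rewrite -[n%:R]ger0_norm // -normrM -kX kM.
Qed.

Variable n : nat.
Variable V : 'cV[R]_n -> R.
Variable c : R.
Hypothesis V_par : forall x y, V (x + y) + V (x - y) = 2 * V x + 2 * V y.
Hypothesis V_ge0 : forall x, 0 <= V x.
Hypothesis V_le : forall x, V x <= c * sqn x.

(** The polar form of [V]; the parallelogram law makes it additive, and the bound
    on [V] makes it homogeneous. *)
Let polar x y : R := (V (x + y) - V (x - y)) / 4.

Let V0 : V 0 = 0.
Proof. by have := V_par 0 0; rewrite subrr addr0; lra. Qed.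

Let VN x : V (- x) = V x.
Proof. by have := V_par 0 x; rewrite V0 sub0r add0r; lra. Qed.

Let polarC x y : polar x y = polar y x.
Proof. by rewrite /polar (addrC x y) -(VN (y - x)) opprB. Qed.

Let polar0 y : polar 0 y = 0.
Proof. by rewrite /polar add0r sub0r VN subrr mul0r. Qed.

Let polar_par x x' y : polar (x + x') y + polar (x - x') y = 2 * polar x y.
Proof.
have h1 := V_par (x + y) x'; have h2 := V_par (x - y) x'.
rewrite /polar ![x + x' + _]addrAC ![x - x' + _]addrAC.
move: h1 h2; rewrite /=; lra.
Qed.

Let polarDl x x' y : polar (x + x') y = polar x y + polar x' y.
Proof.
have half (z : 'cV[R]_n) : z = 2^-1 *: z + 2^-1 *: z.
  by rewrite -scalerDl -[LHS]scale1r; congr (_ *: _); field.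
pose u := 2^-1 *: (x + x'); pose v := 2^-1 *: (x - x').
have h1 := polar_par u v y.
have h2 := polar_par u u y.
have eu : u + u = x + x' by rewrite -half.
have ex : u + v = x.
  rewrite /u /v -scalerDr addrACA subrr addr0 -mulr2n -(scaler_nat 2 x) scalerA.
  by rewrite mulVf // scale1r.
have ex' : u - v = x'.
  rewrite /u /v -scalerBr opprB addrC addrA subrK -mulr2n -(scaler_nat 2 x') scalerA.
  by rewrite mulVf // scale1r.
by move: h1 h2; rewrite eu ex ex' subrr polar0; lra.
Qed.

Let polarZl a x y : polar (a *: x) y = a * polar x y.
Proof.
have c0 : 0 <= c * sqn x by exact: le_trans (V_ge0 _) (V_le x).
have hD u v : polar ((u + v) *: x) y = polar (u *: x) y + polar (v *: x) y.
  by rewrite scalerDl polarDl.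
have := @bounded_additive_linear (fun a => polar (a *: x) y)
  (c * sqn x + V y) hD _ a.
rewrite scale1r; apply => u /andP[u0 u1].
have h1 := V_ge0 (u *: x + y); have h2 := V_ge0 (u *: x - y).
have h3 := V_par (u *: x) y; have h4 := V_ge0 y.
have h5 : V (u *: x) <= c * sqn x.
  apply: le_trans (V_le _) _; rewrite sqnZ mulrCA ler_piMl //.
  by rewrite expr_le1.
rewrite ler_norml /polar; apply/andP; split; lra.
Qed.

(** The Jordan-von Neumann theorem, for nonnegative forms of at most quadratic
    growth. *)
Lemma parallelogram_quad : exists P : 'M[R]_n, P^T = P /\ forall x, V x = quad P x.
Proof.
pose e i : 'cV[R]_n := delta_mx i 0.
exists (\matrix_(i, j) polar (e i) (e j)); split.
  by apply/matrixP => i j; rewrite !mxE polarC.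
move=> x.
have Vp : V x = polar x x.
  rewrite /polar subrr V0; have := V_par x x; rewrite subrr V0.
  lra.
have suml (I : Type) (r : seq I) (f : I -> 'cV[R]_n) y :
    polar (\sum_(i <- r) f i) y = \sum_(i <- r) polar (f i) y.
  elim: r => [|i r IH]; first by rewrite !big_nil polar0.
  by rewrite !big_cons polarDl IH.
have xe : x = \sum_i x i 0 *: e i.
  apply/matrixP => i j; rewrite ord1 summxE (bigD1 i) //= big1 => [|k ki].
    by rewrite !mxE !eqxx mulr1 addr0.
  by rewrite !mxE (eq_sym i) (negPf ki) mulr0.
have expand y : polar x y = \sum_i x i 0 * polar (e i) y.
  rewrite [X in polar X _]xe suml; apply: eq_bigr => i _.
  exact: polarZl.
rewrite Vp expand /quad dotE; apply: eq_bigr => i _; congr (_ * _).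
rewrite polarC expand mxE; apply: eq_bigr => j _.
by rewrite mxE polarC mulrC.
Qed.

End JordanVonNeumann.

(** * Joint convexity of [y^T X^-1 y] *)

Section QuadConvexity.
Variables (R : realType) (n : nat).

Lemma quad_convex (M : 'M[R]_n) (s : R) x y : M^T = M -> (forall z, 0 <= quad M z) ->
  0 <= s <= 1 ->
  quad M ((1 - s) *: x + s *: y) <= (1 - s) * quad M x + s * quad M y.
Proof.
move=> sM M0 /andP[s0 s1]; rewrite -subr_ge0.
have -> : (1 - s) * quad M x + s * quad M y - quad M ((1 - s) *: x + s *: y)
    = s * (1 - s) * quad M (x - y).
  by rewrite !quadD // quadN !quadZ mulmxN dotNr -!scalemxAr !dotZl !dotZr; ring.
by rewrite !mulr_ge0 // subr_ge0.
Qed.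

(** Completing the square. With [X = P^-1], it says that [y^T X^-1 y] bounds
    [2 * dot h y - quad X h] for every [h]; by [quad_inv_eq] the bound is attained
    at [h = X^-1 y]. *)
Lemma quad_inv_ge (P : 'M[R]_n) (h y : 'cV[R]_n) : positive_definite P ->
  2 * dot h y - quad (invmx P) h <= quad P y.
Proof.
move=> pP; have uP := posdef_unit pP; case: (pP) => sP _.
have := posdef_quad_ge0 pP (y - invmx P *m h).
rewrite quadD // quadN mulmxN dotNr (mulmxA P) mulmxV // mul1mx (dotC y h).
have -> : quad P (invmx P *m h) = quad (invmx P) h.
  by rewrite /quad (mulmxA P) mulmxV // mul1mx dotC.
lra.
Qed.

Lemma quad_inv_eq (X : 'M[R]_n) (y : 'cV[R]_n) : positive_definite X ->
  quad (invmx X) y = 2 * dot (invmx X *m y) y - quad X (invmx X *m y).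
Proof.
move=> pX; have uX := posdef_unit pX.
rewrite /quad (mulmxA X) mulmxV // mul1mx (dotC y); ring.
Qed.

Lemma quad_mxD (X Y : 'M[R]_n) a b x :
  quad (a *: X + b *: Y) x = a * quad X x + b * quad Y x.
Proof. by rewrite /quad mulmxDl -!scalemxAl dotDr !dotZr. Qed.

Lemma posdef_comb (X Y : 'M[R]_n) (s : R) : positive_definite X ->
  positive_definite Y -> 0 <= s <= 1 -> positive_definite ((1 - s) *: X + s *: Y).
Proof.
move=> pX pY /andP[s0 s1]; case: (pX) (pY) => sX _ [sY _]; split.
  by rewrite linearD /= !linearZ /= sX sY.
move=> x x0; rewrite quadE quad_mxD.
have hX := posdef_quad pX x0; have hY := posdef_quad pY x0.
have [->|s1'] := eqVneq s 1; first by rewrite subrr mul0r add0r mul1r.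
have s1'' : 0 < 1 - s by rewrite subr_gt0 lt_neqAle s1' s1.
by rewrite ltr_pwDl ?mulr_gt0 // mulr_ge0 // ltW.
Qed.

(** The map [(X, y) |-> y^T X^-1 y] is jointly convex, as a supremum of maps
    that are affine in [(X, y)]. *)
Lemma quad_inv_convex (P0 P1 : 'M[R]_n) (s : R) y0 y1 :
  positive_definite P0 -> positive_definite P1 -> 0 <= s <= 1 ->
  quad (invmx ((1 - s) *: invmx P0 + s *: invmx P1)) ((1 - s) *: y0 + s *: y1)
    <= (1 - s) * quad P0 y0 + s * quad P1 y1.
Proof.
move=> pP0 pP1 hs; case/andP: (hs) => s0 s1.
have pX := posdef_comb (posdef_inv pP0) (posdef_inv pP1) hs.
rewrite quad_inv_eq //; set h := invmx _ *m _.
rewrite dotDr !dotZr quad_mxD.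
have h0 := quad_inv_ge h y0 pP0; have h1 := quad_inv_ge h y1 pP1.
have s1' : 0 <= 1 - s by rewrite subr_ge0.
have := lerD (ler_wpM2l s1' h0) (ler_wpM2l s0 h1); lra.
Qed.

Lemma quad_delta (P : 'M[R]_n) i j :
  dot (delta_mx i 0) (P *m delta_mx j 0) = P i j.
Proof. by rewrite /dot trmx_delta -colE -rowE !mxE. Qed.

Lemma norm_mx_le m (M : 'M[R]_(m, n)) (c : R) : 0 <= c ->
  (forall i j, `|M i j| <= c) -> `|M| <= c.
Proof.
move=> c0 h; rewrite [leLHS]/Num.norm /= mx_normrE.
by apply: bigmax_le => // -[i j] _; apply: h.
Qed.

Lemma norm_mulmx_le m p (M : 'M[R]_(m, n)) (N : 'M[R]_(n, p)) :
  `|M *m N| <= n%:R * (`|M| * `|N|).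
Proof.
have e a b (L : 'M[R]_(a, b)) i j : `|L i j| <= `|L|.
  rewrite [leRHS]/Num.norm /= mx_normrE.
  exact: (@le_bigmax _ R _ 0 (fun ij : 'I_a * 'I_b => `|L ij.1 ij.2|) (i, j)).
rewrite [leLHS]/Num.norm /= mx_normrE.
apply: bigmax_le => [|[i j] _] /=; first by rewrite !mulr_ge0.
rewrite mxE; apply: le_trans (ler_norm_sum _ _ _) _.
rewrite mulr_natl -[X in _ *+ X]card_ord -sumr_const; apply: ler_sum => k _.
by rewrite normrM ler_pM.
Qed.

(** For [s <= 1/2] the matrix [X = (1 - s) P0^-1 + s P1^-1] dominates half of
    [P0^-1], hence [X^-1 <= 2 P0]; the entries of a positive definite matrix are
    bounded by its diagonal. *)
Lemma inv_comb_bounded (P0 P1 : 'M[R]_n) :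
  positive_definite P0 -> positive_definite P1 ->
  exists2 c : R, 0 <= c & forall s, 0 <= s <= 2^-1 ->
    `|invmx ((1 - s) *: invmx P0 + s *: invmx P1)| <= c.
Proof.
move=> pP0 pP1; case: (pP0) => sP0 _.
have d0 i : 0 <= P0 i i.
  by rewrite -quad_delta; apply: posdef_quad_ge0.
have c0 : 0 <= \sum_i P0 i i by rewrite sumr_ge0.
exists (2 * \sum_i P0 i i) => [|s /andP[s0 s2]]; first by rewrite mulr_ge0.
have hs : 0 <= s <= 1 by rewrite s0 (le_trans s2) // invf_le1 // ler1n.
have pX := posdef_comb (posdef_inv pP0) (posdef_inv pP1) hs.
set X := _ + _ in pX *; have pY := posdef_inv pX; case: (pY) => sY _.
have le y : quad (invmx X) y <= 2 * quad P0 y.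
  rewrite quad_inv_eq // quad_mxD; set h := invmx _ *m _.
  have h1 : 0 <= quad (invmx P1) h by apply: posdef_quad_ge0; apply: posdef_inv.
  have h0 : 0 <= quad (invmx P0) h by apply: posdef_quad_ge0; apply: posdef_inv.
  have := quad_inv_ge (2^-1 *: h) y pP0; rewrite dotZl quadZ.
  have := mulr_ge0 s0 h1.
  have : 2^-1 * quad (invmx P0) h <= (1 - s) * quad (invmx P0) h.
    by rewrite ler_wpM2r //; lra.
  lra.
have diag i : invmx X i i <= 2 * \sum_i P0 i i.
  have := le (delta_mx i 0); rewrite /quad !quad_delta => h.
  apply: le_trans h _; rewrite ler_pM2l // (bigD1 i) //= lerDl.
  by rewrite sumr_ge0.
have diag0 i : 0 <= invmx X i i.
  by rewrite -quad_delta; apply: posdef_quad_ge0.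
apply: norm_mx_le => [|i j]; first by rewrite mulr_ge0.
have c0' : 0 <= 2 * \sum_i P0 i i by rewrite mulr_ge0.
rewrite -ler_sqr ?nnegrE // real_normK ?num_real //.
have := quad_cauchy_schwarz (delta_mx i 0) (delta_mx j 0) sY (posdef_quad_ge0 pY).
rewrite /quad !quad_delta => /le_trans; apply; rewrite expr2.
by apply: ler_pM.
Qed.

End QuadConvexity.

(** * The bounded real lemma *)

Section BoundedReal.
Variables (R : realType) (nx nu nw : nat).
Variables (A : 'M[R]_nx) (B : 'M[R]_(nx, nu)) (Bw : 'M[R]_(nx, nw)).
Variables (Q : 'M[R]_nx) (Ru : 'M[R]_nu).
Hypothesis rankBw : row_free Bw.
Hypotheses (Qpd : positive_definite Q) (Rpd : positive_definite Ru).
Local Notation C := R[i].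
Local Notation J := (hinf_cost A B Bw Q Ru).
Local Notation T := (Tzw A B Bw Q Ru).
Local Notation stab := (stabilizing_gains A B).

Definition dissipative (P : 'M[R]_nx) (K : 'M[R]_(nu, nx)) (b : R) :=
  forall (x : 'cV[R]_nx) (w : 'cV[R]_nw),
    quad P ((A + B *m K) *m x + Bw *m w) + quad Q x + quad Ru (K *m x)
      <= quad P x + b * sqn w.

(** On a window at whose ends the state vanishes, the Fourier coefficients of the
    state are exactly the responses to those of the input, so Parseval turns the
    frequency-wise bound into an energy bound. *)
Lemma closed_loop_gain K (x : nat -> 'cV[R]_nx) (w : nat -> 'cV[R]_nw) N : stab K ->
  x 0%N = 0 -> x N = 0 ->
  (forall t, x t.+1 = (A + B *m K) *m x t + Bw *m w t) ->
  \sum_(t < N) sqn (cl_output Q Ru K *m x t) <= J K ^+ 2 * \sum_(t < N) sqn (w t).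
Proof.
move=> sK x0 xN hx.
case: N xN => [|N] xN; first by rewrite !big_ord0 mulr0.
rewrite -(ler_pM2l (ltr0Sn R N)) mulrCA.
rewrite -(parseval (fun t => cl_output Q Ru K *m x t) N.+1) -(parseval w) mulr_sumr.
apply: ler_sum => k _; set om := 2 * pi * k%:R / N.+1%:R.
have om_in : om \in `[0, 2 * pi]%R.
  have p0 := pi_ge0 R.
  rewrite in_itv /= /om divr_ge0 ?mulr_ge0 //= ler_pdivrMr //.
  by rewrite ler_wpM2l ?mulr_ge0 // ler_nat ltnW.
have e : cl_res A B K om (dft x N.+1 om) = complexmx Bw *m dft w N.+1 om.
  rewrite /cl_res (dft_shift om x0 xN) (dft_mul (A + B *m K)) dft_mul.
  have -> : dft (fun t => x t.+1) N.+1 om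
      = dft (fun t => (A + B *m K) *m x t + Bw *m w t) N.+1 om.
    by rewrite /dft; apply: eq_bigr => t _; rewrite hx.
  by rewrite dft_add addrC addKr.
have := @hinf_cost_ub R nx nu nw A B Bw Q Ru K om (dft w N.+1 om) sK om_in.
rewrite Tzw_mul -(cl_state_unique sK e) dft_mul => h.
rewrite -!cnorm_sqr -exprMn ler_sqr ?nnegrE ?cnorm_ge0 //.
by rewrite mulr_ge0 ?cnorm_ge0 // hinf_cost_ge0.
Qed.

(** The available storage at level [J K ^+ 2] is finite, quadratic and dissipative;
    it dominates the output energy of one step, hence is positive definite. Full
    row rank of [Bw] makes every state reachable in one step, which is why the
    level [J K ^+ 2] itself, and not only larger ones, is attained. *)
Lemma bounded_real K : stab K ->
  exists P : 'M[R]_nx, positive_definite P /\ dissipative P K (J K ^+ 2).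
Proof.
move=> sK; have /row_freeP[Br hBr] := rankBw.
have g0 : 0 <= J K ^+ 2 by exact: sqr_ge0.
have gain := fun x w N => @closed_loop_gain K x w N sK.
set F := A + B *m K in gain; set H := cl_output Q Ru K in gain.
have sF : spectral_radius F < 1 by exact: sK.
pose V := storage F Bw H (J K ^+ 2).
have Hpos x : x != 0 -> 0 < sqn (H *m x).
  move=> x0; rewrite cl_output_sqn //.
  by rewrite ltr_pwDl ?posdef_quad // posdef_quad_ge0.
have Vout x : sqn (H *m x) <= V x by exact: (storage_output sF hBr g0 gain).
have [|||P [sP hP]] :=
  @parallelogram_quad R nx V (J K ^+ 2 * (nw%:R * nx%:R * `|Br|) ^+ 2).
- exact: (storage_parallelogram sF hBr g0 gain).
- by move=> x; apply: le_trans (Vout x); apply: sqn_ge0.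
- move=> x; apply: le_trans (storage_ub sF hBr g0 gain x) _.
  by rewrite -mulrA ler_wpM2l // sqn_mul_le.
exists P; split.
  split=> // x x0; rewrite quadE -hP.
  exact: lt_le_trans (Hpos x x0) (Vout x).
move=> x w; rewrite -!hP.
have := storage_dissipative sF hBr g0 gain x w.
rewrite -/V cl_output_sqn // -/F; lra.
Qed.

Lemma dissipative_complex P K b (x : 'cV[C]_nx) (v : 'cV[C]_nw) :
  dissipative P K b ->
  cquad P (complexmx (A + B *m K) *m x + complexmx Bw *m v) + cquad Q x
    + cquad Ru (complexmx K *m x) <= cquad P x + b * csqn v.
Proof.
move=> h; have := lerD (h (rpart x) (rpart v)) (h (ipart x) (ipart v)).
rewrite /cquad /csqn rpartD ipartD !rpart_mul !ipart_mul; lra.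
Qed.

Lemma posdef_cquad_ge0 n (P : 'M[R]_n) (x : 'cV[C]_n) :
  positive_definite P -> 0 <= cquad P x.
Proof. by move=> pP; rewrite addr_ge0 // posdef_quad_ge0. Qed.

Lemma posdef_cquad_gt0 n (P : 'M[R]_n) (x : 'cV[C]_n) :
  positive_definite P -> x != 0 -> 0 < cquad P x.
Proof.
move=> pP x0; rewrite /cquad; have [r0|r0] := eqVneq (rpart x) 0.
  rewrite r0 quad0 add0r posdef_quad //; apply: contra_neq x0 => i0.
  exact: reim_eq0.
by rewrite ltr_pwDl ?posdef_quad // posdef_quad_ge0.
Qed.

(** At an eigenvector for [l] the inequality reads [|l|^2 p + q <= p] with
    [p, q > 0]. *)
Lemma dissipative_stable P K b : positive_definite P -> dissipative P K b -> stab K.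
Proof.
move=> pP hP; apply/spectral_radius_lt1P => l /eigenvalue_colP[v v0 hv].
have := dissipative_complex v 0 hP.
rewrite mulmx0 addr0 hv cquadZ; last by case: pP.
have -> : csqn (0 : 'cV[C]_nw) = 0 by rewrite -cnorm_sqr cnorm0 expr0n.
have q0 := posdef_cquad_gt0 Qpd v0; have p0 := posdef_cquad_gt0 pP v0.
have r0 := posdef_cquad_ge0 (complexmx K *m v) Rpd.
rewrite mulr0 addr0 => h; rewrite ltNge; apply/negP => l1.
have : cquad P v <= Normc.normc l ^+ 2 * cquad P v.
  by rewrite ler_peMl ?exprn_ege1 // ltW.
lra.
Qed.

(** At a harmonic state [x] the next state is [e^(jw) x], on which the form [P]
    takes the same value as on [x]; it cancels and leaves the gain bound. *)
Lemma dissipative_cost P K b : positive_definite P -> 0 <= b ->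
  dissipative P K b -> J K <= Num.sqrt b.
Proof.
move=> pP b0 hP; have sK := dissipative_stable pP hP.
apply: hinf_cost_le => [|w _ v]; first exact: sqrtr_ge0.
rewrite Tzw_mul; set x := cl_state A B Bw K w v.
have e : cexpi w *: x = complexmx (A + B *m K) *m x + complexmx Bw *m v.
  by rewrite -(cl_stateE Bw w v sK) addrC subrK.
have := dissipative_complex x v hP.
rewrite -e cquadZ; last by case: pP.
rewrite normc_cexpi expr1n mul1r => h.
rewrite /cnorm -sqrtrM // ler_sqrt ?mulr_ge0 ?csqn_ge0 //.
rewrite /csqn rpart_mul ipart_mul !cl_output_sqn // -rpart_mul -ipart_mul.
by move: h; rewrite /cquad /csqn; lra.
Qed.

(** In the variables [X = P^-1] and [L = K X] the dissipation inequality defines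
    a convex set: every term of it is convex or affine in [(X, L, b)] once the
    state is written as [X h]. *)
Lemma dissipative_comb P0 K0 b0 P1 K1 b1 s :
  positive_definite P0 -> positive_definite P1 -> 0 <= s <= 1 ->
  dissipative P0 K0 b0 -> dissipative P1 K1 b1 ->
  let P := invmx ((1 - s) *: invmx P0 + s *: invmx P1) in
  positive_definite P /\
  dissipative P (K0 + s *: ((K1 - K0) *m invmx P1 *m P)) ((1 - s) * b0 + s * b1).
Proof.
move=> pP0 pP1 hs h0 h1; case/andP: (hs) => s0 s1.
have s1' : 0 <= 1 - s by rewrite subr_ge0.
have pX := posdef_comb (posdef_inv pP0) (posdef_inv pP1) hs.
have uX := posdef_unit pX.
set X := _ + _ in pX uX *; move=> P; have pP : positive_definite P by exact: posdef_inv.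
split=> // x w; set K := K0 + _.
pose h := P *m x; pose x0 := invmx P0 *m h; pose x1 := invmx P1 *m h.
have xE : x = (1 - s) *: x0 + s *: x1.
  by rewrite /x0 /x1 !scalemxAl -mulmxDl /h mulmxA mulmxV // mul1mx.
have KxE : K *m x = (1 - s) *: (K0 *m x0) + s *: (K1 *m x1).
  rewrite /K mulmxDl -scalemxAl -!mulmxA -/h -/x1 [in LHS]xE mulmxDr -!scalemxAr.
  rewrite mulmxBl; move: (K0 *m x0) (K0 *m x1) (K1 *m x1) => a b c.
  by apply/matrixP => i j; rewrite !mxE; ring.
have yE : (A + B *m K) *m x + Bw *m w =
    (1 - s) *: ((A + B *m K0) *m x0 + Bw *m w) + s *: ((A + B *m K1) *m x1 + Bw *m w).
  rewrite !mulmxDl -!mulmxA KxE [X in A *m X]xE !mulmxDr -!scalemxAr.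
  move: (A *m x0) (A *m x1) (B *m _) (B *m _) (Bw *m w) => a a' c c' d.
  by apply/matrixP => i j; rewrite !mxE; ring.
have c1 := quad_inv_convex ((A + B *m K0) *m x0 + Bw *m w)
  ((A + B *m K1) *m x1 + Bw *m w) pP0 pP1 hs.
have sQ : Q^T = Q by case: Qpd.
have sR : Ru^T = Ru by case: Rpd.
have c2 := quad_convex x0 x1 sQ (posdef_quad_ge0 Qpd) hs.
have c3 := quad_convex (K0 *m x0) (K1 *m x1) sR (posdef_quad_ge0 Rpd) hs.
have d0 := ler_wpM2l s1' (h0 x0 w); have d1 := ler_wpM2l s0 (h1 x1 w).
have pE : quad P x = (1 - s) * quad P0 x0 + s * quad P1 x1.
  have inv M : positive_definite M -> quad M (invmx M *m h) = quad (invmx M) h.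
    move=> pM; have uM := posdef_unit pM.
    by rewrite /quad (mulmxA M) mulmxV // mul1mx dotC.
  rewrite /x0 /x1 !inv // -quad_mxD -/X.
  by rewrite /quad /h mulmxA mulmxV // mul1mx dotC.
move: c1 c2 c3 d0 d1; rewrite -/X -/P -yE -xE -KxE pE; lra.
Qed.

End BoundedReal.

(** * Clarke stationarity *)

Section Clarke.
Variables (R : realType) (V : normedModType R).

Lemma clarke_derivative_le (f : V -> R) (x d : V) (r tau c : R) :
  0 < r -> 0 < tau ->
  (forall y t, `|y - x| < r -> 0 < t < tau -> (f (y + t *: d) - f y) / t <= c) ->
  (clarke_derivative f x d <= c%:E)%E.
Proof.
move=> r0 tau0 h; rewrite /clarke_derivative limf_esupE.
pose W := [set p : V * R | `|p.1 - x| < r /\ 0 < p.2 < tau].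
apply: (@le_trans _ _ (ereal_sup
  ((fun p : V * R => ((f (p.1 + p.2 *: d) - f p.1) / p.2)%:E) @` W))).
  apply: ereal_inf_lbound; exists W => //.
  exists ([set y | `|y - x| < r], [set t | 0 < t < tau]) => /=; last by case.
  split.
    by apply/nbhs_normP; exists r => //= y /=; rewrite distrC.
  near=> t; apply/andP; split; near: t; first exact: nbhs_right_gt.
  exact: nbhs_right_lt.
apply: ge_ereal_sup => _ [[y t] [/= hy ht] <-].
by rewrite lee_fin h.
Unshelve. all: end_near. Qed.

Lemma local_min_clarke_derivative_ge0 (f : V -> R) (x d : V) (r : R) : 0 < r ->
  (forall y, `|y - x| <= r -> f x <= f y) -> (0 <= clarke_derivative f x d)%E.
Proof.
move=> r0 fmin; pose tau := r / (`|d| + 1).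
have d0 : 0 < `|d| + 1 by rewrite ltr_wpDl.
have tau0 : 0 < tau by rewrite divr_gt0.
have h t : 0 < t < tau -> f x <= f (x + t *: d).
  move=> /andP[t0]; rewrite ltr_pdivlMr // => tr.
  apply: fmin; rewrite addrAC subrr add0r normrZ gtr0_norm //.
  apply: le_trans (ltW tr).
  by rewrite ler_pM2l // lerDl.
rewrite /clarke_derivative limf_esupE.
apply: le_ereal_inf_tmp => _ [W [[W1 W2] [/= hW1 hW2] hW] <-].
have [t [ht W2t]] : exists t, 0 < t < tau /\ W2 t.
  have : \forall t \near (0 : R)^'+, 0 < t < tau /\ W2 t.
    near=> t; split; last by near: t.
    apply/andP; split; near: t; first exact: nbhs_right_gt.
    exact: nbhs_right_lt.
  by move=> /filter_ex[t]; exists t.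
apply: le_trans (ereal_sup_ubound _); last first.
  exists (x, t); last by [].
  by apply: hW; split=> //=; apply: nbhs_singleton.
have /andP[t0 _] := ht.
by rewrite lee_fin divr_ge0 ?(ltW t0) // subr_ge0 h.
Unshelve. all: end_near. Qed.

End Clarke.

(** Converts a decrease of the squared cost into a decrease of the cost. *)
Lemma sqrt_le_tangent (R : realType) (a j : R) : 0 <= a -> 0 < j ->
  Num.sqrt a <= (a + j ^+ 2) / (2 * j).
Proof.
move=> a0 j0; rewrite ler_pdivlMr ?mulr_gt0 //.
have := sqr_ge0 (Num.sqrt a - j); rewrite sqrrB sqr_sqrtr // -mulr_natl.
move: (Num.sqrt a) => u; lra.
Qed.

(** The budget of [weakly_convex_descent]: of the decrease [s * e] over the step
    [s], a quarter is lost to moving the base point by [dl] and half to the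
    curvature error. *)
Lemma quotient_estimate (R : realType) (j jY jYs jt L c s t dl e nD rho : R) :
  0 < s -> 0 < t -> 0 <= c -> 0 <= nD <= rho ->
  jt <= (1 - t / s) * jY + t / s * jYs + c * (t * s * nD ^+ 2) ->
  jYs <= j - s * e + L * dl -> j <= jY + L * dl ->
  L * dl <= s * e / 8 -> c * rho ^+ 2 * s <= e / 2 ->
  (jt - jY) / t <= - (e / 4).
Proof.
move=> s0 t0 c0 /andP[nD0 nDr] h1 h2 h3 h4 h5.
rewrite ler_pdivrMr //.
have h6 : c * (t * s * nD ^+ 2) <= t * (e / 2).
  have -> : c * (t * s * nD ^+ 2) = t * (c * nD ^+ 2 * s) by ring.
  rewrite ler_pM2l //; apply: le_trans h5; rewrite ler_pM2r // ler_wpM2l //.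
  by rewrite ler_sqr ?nnegrE // (le_trans nD0).
have h7 : t / s * (jYs - jY) <= t / s * (s * (- (3 / 4) * e)).
  by rewrite ler_pM2l ?divr_gt0 //; lra.
have e1 : t / s * (s * (- (3 / 4) * e)) = - (3 / 4) * e * t by field; rewrite gt_eqF.
have e2 : (1 - t / s) * jY + t / s * jYs = jY + t / s * (jYs - jY) by ring.
lra.
Qed.

(** Descent over a fixed step [s] suffices: weak convexity carries the difference
    quotient over [s] down to every [t <= s] up to an error of order [s], and the
    Lipschitz property moves the base point, so that one direction [D] decreases
    [f] uniformly near [K]. *)
Lemma weakly_convex_descent (R : realType) (V : normedModType R) (f : V -> R)
    (K : V) (r L c e rho : R) :
  0 < r -> 0 <= L -> 0 <= c -> 0 < e -> 0 < rho ->
  (forall Y Y', `|Y - K| <= r -> `|Y' - K| <= r -> f Y' <= f Y + L * `|Y' - Y|) ->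
  (forall (Y D : V) (s t : R), 0 < s -> 0 <= t <= s ->
     `|Y - K| <= r -> `|Y + t *: D - K| <= r -> `|Y + s *: D - K| <= r ->
     f (Y + t *: D) <= (1 - t / s) * f Y + t / s * f (Y + s *: D)
                       + c * (t * s * `|D| ^+ 2)) ->
  (forall s, 0 < s <= 2^-1 ->
     exists D : V, `|D| <= rho /\ f (K + s *: D) <= f K - s * e) ->
  exists D : V, (clarke_derivative f K D < 0)%E.
Proof.
move=> r0 L0 c0 e0 rho0 lip wc hsteps.
have c1 : 0 < 2 * (c * rho ^+ 2 + 1).
  by rewrite mulr_gt0 // ltr_wpDl // mulr_ge0 // sqr_ge0.
(* [s * rho <= r / 2] keeps the step inside the ball, and [c * rho^2 * s <= e / 2]
   bounds the curvature error. *)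
pose s := Num.min 2^-1 (Num.min (r / (2 * rho)) (e / (2 * (c * rho ^+ 2 + 1)))).
have s0 : 0 < s.
  by rewrite !lt_min invr_gt0 ltr0Sn /= !divr_gt0 // mulr_gt0.
have s2 : s <= 2^-1 by rewrite ge_min lexx.
have sr : s * rho <= r / 2.
  have : s <= r / (2 * rho) by rewrite !ge_min lexx !orbT.
  rewrite ler_pdivlMr ?mulr_gt0 // => h; lra.
have sc : c * rho ^+ 2 * s <= e / 2.
  have : s <= e / (2 * (c * rho ^+ 2 + 1)) by rewrite !ge_min lexx !orbT.
  rewrite ler_pdivlMr // => h; lra.
have [|D [Drho fD]] := hsteps s; first by rewrite s0.
pose dl := Num.min (r / 2) (s * e / (8 * (L + 1))).
have L1 : 0 < 8 * (L + 1) by rewrite mulr_gt0 // ltr_wpDl.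
have dl0 : 0 < dl by rewrite lt_min !divr_gt0 // mulr_gt0.
have dlr : dl <= r / 2 by rewrite ge_min lexx.
have dlL : L * dl <= s * e / 8.
  have : dl <= s * e / (8 * (L + 1)) by rewrite ge_min lexx orbT.
  rewrite ler_pdivlMr // => h; lra.
have normD_le (t : R) : 0 <= t <= s -> `|t *: D| <= r / 2.
  move=> /andP[t0 ts]; rewrite normrZ ger0_norm //; apply: le_trans sr.
  by rewrite ler_pM.
have ball Y (t : R) : `|Y - K| < dl -> 0 <= t <= s -> `|Y + t *: D - K| <= r.
  move=> hY /normD_le ht; rewrite addrAC; apply: le_trans (ler_normD _ _) _.
  by move: (ltW hY) dlr ht; lra.
exists D; apply: (@le_lt_trans _ _ (- (e / 4))%:E); last by rewrite lte_fin; lra.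
apply: (@clarke_derivative_le _ _ f K D dl s) => // Y t hY /andP[t0 ts].
  have hs : 0 <= s <= s by rewrite (ltW s0) lexx.
  have ht : 0 <= t <= s by rewrite !ltW.
  have h0 : (0 : R) <= 0 <= s by apply/andP; split; [exact: lexx | exact: ltW].
  have KK : `|K - K| < dl by rewrite subrr normr0.
  have YK : `|Y - K| <= r by move: (ball Y 0 hY h0); rewrite scale0r addr0.
  have K0 : `|K - K| <= r by rewrite subrr normr0 ltW.
  apply: (@quotient_estimate R (f K) (f Y) (f (Y + s *: D)) _ L c s t dl e `|D| rho
    s0 t0 c0 _ _ _ _ dlL sc).
  - by rewrite normr_ge0.
  - exact: wc s0 ht YK (ball Y t hY ht) (ball Y s hY hs).
  - apply: le_trans (lip _ _ (ball K s KK hs) (ball Y s hY hs)) _.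
    apply: lerD => //; rewrite ler_wpM2l // opprD addrACA subrr addr0.
    exact: ltW.
  - apply: le_trans (lip _ _ YK K0) _; rewrite lerD2l ler_wpM2l //.
    by rewrite distrC ltW.
Qed.

Section Stationarity.
Variables (R : realType) (nx nu nw : nat).
Variables (A : 'M[R]_nx) (B : 'M[R]_(nx, nu)) (Bw : 'M[R]_(nx, nw)).
Variables (Q : 'M[R]_nx) (Ru : 'M[R]_nu).
Hypothesis rankBw : row_free Bw.
Hypotheses (Qpd : positive_definite Q) (Rpd : positive_definite Ru).
Local Notation J := (hinf_cost A B Bw Q Ru).
Local Notation stab := (stabilizing_gains A B).

(** Along the segment between the two certificates in the variables [P^-1] and
    [K P^-1], the squared level decreases linearly. The gain reached at parameter
    [s] is [K + s *: D] with [D] bounded independently of [s]. *)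
Lemma dissipative_descent P0 P1 K K' (j j' : R) :
  positive_definite P0 -> dissipative A B Bw Q Ru P0 K (j ^+ 2) ->
  positive_definite P1 -> dissipative A B Bw Q Ru P1 K' (j' ^+ 2) ->
  0 <= j' -> j' < j ->
  exists e rho : R, [/\ 0 < e, 0 < rho & forall s, 0 < s <= 2^-1 ->
    exists D : 'M[R]_(nu, nx), `|D| <= rho /\ J (K + s *: D) <= j - s * e].
Proof.
move=> pP0 hP0 pP1 hP1 j0' lt; have j0 : 0 < j by exact: le_lt_trans lt.
have [c c0 hc] := inv_comb_bounded pP0 pP1.
exists ((j ^+ 2 - j' ^+ 2) / (2 * j)).
exists (nx%:R * (`|(K' - K) *m invmx P1| * c) + 1); split.
- by rewrite divr_gt0 ?mulr_gt0 // subr_gt0 ltr_sqr ?nnegrE ?(ltW j0).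
- by rewrite ltr_wpDl // !mulr_ge0.
move=> s /andP[s0 s2]; have hs : 0 <= s <= 1.
  by rewrite (ltW s0) (le_trans s2) // invf_le1 // ler1n.
have [pP hP] := dissipative_comb Qpd Rpd pP0 pP1 hs hP0 hP1.
set P := invmx _ in pP hP.
exists ((K' - K) *m invmx P1 *m P); split.
  apply: (@le_trans _ _ (nx%:R * (`|(K' - K) *m invmx P1| * c))); last by rewrite lerDl.
  apply: le_trans (norm_mulmx_le _ _) _; rewrite ler_wpM2l // ler_wpM2l //.
  by apply: hc; rewrite (ltW s0).
have /andP[_ s1] := hs.
have b0 : 0 <= (1 - s) * j ^+ 2 + s * j' ^+ 2.
  by rewrite addr_ge0 // mulr_ge0 ?sqr_ge0 ?subr_ge0 // ltW.
apply: le_trans (dissipative_cost Qpd Rpd pP b0 hP) _.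
apply: le_trans (sqrt_le_tangent b0 j0) _.
by apply: eq_le_r; field; rewrite gt_eqF.
Qed.

Lemma descent_steps K K' : stab K -> stab K' -> J K' < J K ->
  exists e rho : R, [/\ 0 < e, 0 < rho & forall s, 0 < s <= 2^-1 ->
    exists D : 'M[R]_(nu, nx), `|D| <= rho /\ J (K + s *: D) <= J K - s * e].
Proof.
move=> sK sK'; have [P0 [pP0 hP0]] := bounded_real rankBw Qpd Rpd sK.
have [P1 [pP1 hP1]] := bounded_real rankBw Qpd Rpd sK'.
exact: dissipative_descent pP0 hP0 pP1 hP1 (hinf_cost_ge0 Bw Q Ru sK').
Qed.

Lemma stationary_optimal K : stab K ->
  clarke_subdifferential J K 0 -> argmin stab J K.
Proof.
move=> sK st; split; first exact: sK.
move=> K' sK'; rewrite leNgt; apply/negP => lt.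
have [e [rho [e0 rho0 hsteps]]] := descent_steps sK sK' lt.
have [r [L [c [r0 [L0 c0] _ lip wc]]]] := hinf_cost_local Bw Q Ru sK.
have [D] := weakly_convex_descent r0 L0 c0 e0 rho0 lip wc hsteps.
by apply/negP; rewrite -leNgt; move: (st D); rewrite trmx0 mul0mx mxtrace0.
Qed.

Lemma optimal_stationary K : argmin stab J K -> clarke_subdifferential J K 0.
Proof.
move=> [sK hK] D; rewrite trmx0 mul0mx mxtrace0.
have [r [_ [_ [r0 _ stabr _ _]]]] := hinf_cost_local Bw Q Ru sK.
exact: local_min_clarke_derivative_ge0 r0 (fun Y hY => hK Y (stabr Y hY)).
Qed.

End Stationarity.

Theorem corollary1 (R : realType) (nx nu nw : nat)
    (A : 'M[R]_nx) (B : 'M[R]_(nx, nu)) (Bw : 'M[R]_(nx, nw))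
    (Q : 'M[R]_nx) (Ru : 'M[R]_nu)
    (stabAB : stabilizable A B)
    (rankBw : row_free Bw)
    (Qpd : positive_definite Q) (Rpd : positive_definite Ru)
    (Kne : stabilizing_gains A B !=set0)
    (K : 'M[R]_(nu, nx)) (HK : stabilizing_gains A B K) :
  clarke_subdifferential (hinf_cost A B Bw Q Ru) K 0 <->
  argmin (stabilizing_gains A B) (hinf_cost A B Bw Q Ru) K.
Proof.
split; first exact: stationary_optimal.
exact: optimal_stationary.
Qed.
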